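(* Let $\sigma>0$, let $m=\exp_*\mathcal{N}(0,\sigma^2)$ be a $\log$-normal distribution, let $\lambda_{cr}=\lambda_{cr}(m)$ be the critical normalizing constant, and let $\overline{\mathbf{m}}$ be a non-atomic $\mathbf{\Phi}_{\lambda_{cr}}$-stationary random metric. Put $\gamma_{BRW}=\sqrt{2\log 4}\cdot\sigma$. Then: (1) If $\gamma_{BRW}+\log\lambda_{cr}<0$, then $\overline{\mathbf{m}}$ is supported on the set of spaces $(\mathcal{X},d)$ for which the inclusion map $V_\infty\to\mathcal{X}$ extends continuously to a homeomorphism between $\Gamma_\infty$ and $\mathcal{X}$. Moreover, $\overline{\mathbf{m}}$-almost surely, the Hausdorff dimension of $\mathcal{X}$ is at most $$\frac{2\log 2}{|\gamma_{BRW}+\log\lambda_{cr}|}.$$ (2) If $\gamma_{BRW}+\log\lambda_{cr}>0$, then the diameter of the space $\mathcal{X}$ is $\overline{\mathbf{m}}$-almost surely infinite.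
   Context: $\mathbf{R}_+=(0,+\infty)$. Figure eight-graph: $\Gamma$ has vertices $I,M,O$ and four oriented edges: $e_1,e_2$ from $I$ to $M$, and $e_3,e_4$ from $M$ to $O$. $\Gamma_0$ is a single edge from $I$ to $O$; $\Gamma_n$ (vertex set $V_n$) is obtained from $\Gamma_{n-1}$ by replacing each oriented edge $(x,y)$ by a copy of $\Gamma$, with $I$ at $x$ and $O$ at $y$. With $V_n\hookrightarrow V_{n+1}$, put $V_\infty=\bigcup_n V_n$. $\Gamma_\infty$ is the Gromov--Hausdorff limit of the graphs $\Gamma_n$ equipped with the length metric for which every edge has length $2^{-n}$; equivalently, the completion of $V_\infty$ for the resulting (mutually consistent) distances. Thus $V_\infty$ is a dense subset of the compact space $\Gamma_\infty$. $V_\infty$ is obtained from four copies of itself by identifying the $I,O$ points of the $i$-th copy with the initial and final endpoint of $e_i$. $\mathbf{M}$ is the set of complete metric spaces $(\mathcal{X},d)$ that contain $V_\infty$ as a dense subset (determined by $d|_{V_\infty\times V_\infty}$), with the topology of pointwise convergence on $V_\infty\times V_\infty$. For $\lambda>0$, $\mathcal{R}_\lambda:\mathbf{M}^4\times\mathbf{R}_+\to\mathbf{M}$ sends $((\mathcal{X}_i,d_i)_{i=1}^4;\xi)$ to the space obtained by glueing the $\mathcal{X}_i$ in the figure-eight shape (points $I,O$ of $\mathcal{X}_i$ at the initial/final endpoint of $e_i$), with $\lambda\xi$ times the glued (shortest chain) metric. $\mathbf{\Phi}_\lambda[\mathbf{m}]=(\mathcal{R}_\lambda)_*(\mathbf{m}^{\otimes4}\otimes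 m)$ for Radon probability measures $\mathbf{m}$ on $\mathbf{M}$; a $\mathbf{\Phi}_\lambda$-stationary random metric is a Radon probability measure on $\mathbf{M}$ fixed by $\mathbf{\Phi}_\lambda$. Critical constant: let $R_\lambda(X_1,\dots,X_4;\xi)=\lambda\xi(\min(X_1,X_2)+\min(X_3,X_4))$. For $A\in\mathbf{R}_+$ and a probability measure $\mu$ on $[0,+\infty]$ let $\Phi_{A,\lambda}[\mu]$ be the law of $\min(R_\lambda(X_1,\dots,X_4;\xi),A)$, with $X_i$ i.i.d. of law $\mu$ and $\xi$ independent of law $m$. The iterates $\Phi_{A,\lambda}^n[\delta_\infty]$ are stochastically decreasing and converge weakly to a measure $\nu_{A,\lambda}$. Let $\Lambda=\{\lambda>0:\nu_{A,\lambda}\ne\delta_0\}$ (independent of $A$) and $\lambda_{cr}(m)=\inf\Lambda\in(0,\infty)$; for this value a non-atomic stationary random metric exists. *)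

(* Defs.v *)
From HB Require Import structures.
From mathcomp Require Import all_boot all_order all_algebra.
From mathcomp Require Import all_classical all_reals all_analysis.
From mathcomp Require Import measurable_realfun zify ring lra.

Set Implicit Arguments.
Unset Strict Implicit.
Unset Printing Implicit Defensive.

Import Order.TTheory GRing.Theory Num.Theory.
Import numFieldNormedType.Exports.

Local Open Scope classical_set_scope.
Local Open Scope ring_scope.

(* The edges of [Gamma_n] are the words of length [n] over the edges
   [e_1, .., e_4] of the figure eight (here [0, .., 3 : 'I_4]), the most recent
   replacement coming first: [i :: w] is the edge [e_i] of the copy of [Gamma]
   that replaces the edge [w].  Apart from [I] and [O], every vertex is the
   point [M] of the copy of [Gamma] replacing exactly one edge [w]. *)
Inductive Vinf := vI | vO | vMid of seq 'I_4.

Definition Vinf_code (v : Vinf) : bool + seq 'I_4 :=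
  match v with vI => inl false | vO => inl true | vMid w => inr w end.
Definition Vinf_decode (c : bool + seq 'I_4) : Vinf :=
  match c with inl b => if b then vO else vI | inr w => vMid w end.
Lemma Vinf_codeK : cancel Vinf_code Vinf_decode. Proof. by case. Qed.
HB.instance Definition _ := Countable.copy Vinf (can_type Vinf_codeK).
HB.instance Definition _ := isPointed.Build Vinf vI.

(* [(initial endpoint, final endpoint)] of the edge [w]. *)
Fixpoint ends (w : seq 'I_4) : Vinf * Vinf :=
  match w with
  | [::] => (vI, vO)
  | i :: w' =>
      if (i < 2)%N then ((ends w').1, vMid w') else (vMid w', (ends w').2)
  end.

Definition inV (n : nat) (v : Vinf) : bool :=
  if v is vMid w then (size w < n)%N else true.

(* Inclusion of the [i]-th of the four copies of [V_infty] in [V_infty]. *)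
Definition copy (i : 'I_4) (v : Vinf) : Vinf :=
  match v with
  | vI => (ends [:: i]).1
  | vO => (ends [:: i]).2
  | vMid w => vMid (rcons w i)
  end.

Lemma ends_rcons w i :
  ends (rcons w i) = (copy i (ends w).1, copy i (ends w).2).
Proof.
elim: w => [|j w IH] //=; first by case: ifP.
by rewrite IH; case: ifP.
Qed.

Definition adj (n : nat) : rel Vinf := fun x y =>
  [exists w : n.-tuple 'I_4, (ends w == (x, y)) || (ends w == (y, x))].

(* Distance between two vertices of [Gamma_n], each edge having length
   [2 ^- n]. *)
Definition graph_dist (R : realType) (n : nat) (x y : Vinf) : R :=
  inf [set (size p)%:R / 2 ^+ n
      | p in [set p : seq Vinf | path (adj n) x p /\ last x p = y]].

Definition level (v : Vinf) : nat := if v is vMid w then (size w).+1 else 0%N.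

(* The common value of the [graph_dist n x y] over the [n] such that [x] and
   [y] are vertices of [Gamma_n]; see [std_distE]. *)
Definition std_dist (R : realType) (xy : Vinf * Vinf) : R :=
  graph_dist R (maxn (level xy.1) (level xy.2)) xy.1 xy.2.

Lemma adjP n x y : reflect
  (exists2 w, size w = n & ends w = (x, y) \/ ends w = (y, x)) (adj n x y).
Proof.
apply: (iffP existsP) => [[w /orP wxy]|[w sw wxy]].
  by exists (tval w); [rewrite size_tuple|case: wxy => /eqP; [left|right]].
have sw' : size w == n by apply/eqP.
by exists (Tuple sw') => /=; apply/orP; case: wxy => /eqP; [left|right].
Qed.

Lemma adj_sym n : symmetric (adj n).
Proof. by move=> x y; apply: eq_existsb => w; rewrite orbC. Qed.

Lemma inVS n m v : (n <= m)%N -> inV n v -> inV m v.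
Proof. by case: v => //= w nm /leq_trans; exact. Qed.

Lemma ends_inV n w : (size w <= n)%N -> inV n (ends w).1 && inV n (ends w).2.
Proof.
elim: w n => [|i w IH] n //= swn.
have /andP[h1 h2] := IH n (ltnW swn).
by case: ifP => _ /=; rewrite ?h1 ?h2 swn.
Qed.

Definition walk n x y (p : seq Vinf) := path (adj n) x p /\ last x p = y.

Lemma walk_cat n x y z p q : walk n x y p -> walk n y z q -> walk n x z (p ++ q).
Proof. by move=> [hp <-] [hq <-]; split; rewrite ?cat_path ?last_cat ?hp. Qed.

Lemma walk_rev n x y p : walk n x y p -> walk n y x (rev (belast x p)).
Proof.
move=> [hp <-]; split.
  by rewrite rev_path (eq_path (e' := adj n)) // => a b; rewrite adj_sym.
by case: p hp => //= a p _; rewrite rev_cons last_rcons.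
Qed.

Lemma adj_src n w : size w = n -> adj n.+1 (ends w).1 (vMid w).
Proof. by move=> sw; apply/adjP; exists (ord0 :: w) => /=; [lia|left]. Qed.

Lemma adj_tgt n w : size w = n -> adj n.+1 (vMid w) (ends w).2.
Proof.
by move=> sw; apply/adjP; exists (ord_max :: w) => /=; [lia|left].
Qed.

Lemma adj_up n x y : adj n x y -> exists2 p, walk n.+1 x y p & size p = 2.
Proof.
move=> /adjP[w sw wxy]; have hs := adj_src sw; have ht := adj_tgt sw.
case: wxy => e; rewrite e /= in hs ht.
  by exists [:: vMid w; y] => //; split => //=; rewrite hs ht.
exists [:: vMid w; y] => //; split => //=.
by rewrite adj_sym ht /= adj_sym hs.
Qed.

Lemma walk_up n x y p : walk n x y p ->
  exists2 q, walk n.+1 x y q & size q = (2 * size p)%N.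
Proof.
elim: p x => [|a p IH] x [/= hp hl]; first by exists [::].
move: hp => /andP[/adj_up[q1 hq1 sq1] hp].
have [q2 hq2 sq2] := IH a (conj hp hl).
by exists (q1 ++ q2); [exact: walk_cat hq1 hq2|rewrite size_cat; lia].
Qed.

Lemma walk_exI n x : inV n x -> exists p, walk n vI x p.
Proof.
elim: n x => [|n IH] x.
  case: x => [_|_|w] //; first by exists [::].
  by exists [:: vO]; split => //=; rewrite andbT; apply/adjP; exists [::] => //; left.
move=> hx; case: (boolP (inV n x)) => [/IH[p /walk_up[q hq _]]|hnx].
  by exists q.
case: x hx hnx => //= w hw1 hw2; have sw : size w = n by lia.
have swn : (size w <= n)%N by lia.
have /andP[h1 _] := ends_inV swn.
have [p /walk_up[q hq _]] := IH _ h1.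
exists (q ++ [:: vMid w]); apply: walk_cat hq _; split => //=.
by rewrite adj_src.
Qed.

Lemma walk_ex n x y : inV n x -> inV n y -> exists p, walk n x y p.
Proof.
move=> /walk_exI[p hp] /walk_exI[q hq].
by exists (rev (belast vI p) ++ q); apply: walk_cat hq; exact: walk_rev.
Qed.

Lemma walk_down n x y p : inV n x -> inV n y -> walk n.+1 x y p ->
  exists2 q, walk n x y q & (2 * size q <= size p)%N.
Proof.
have [k] := ubnP (size p); elim: k => // k IH in x p *.
case: p => [|a p]; first by move=> _ _ _ [_ /= <-]; exists [::].
move=> sp hx hy [/= /andP[/adjP[w sw wxa] hp] hl].
case: w sw wxa => // i w [sw] wxa.
have swn : (size w <= n)%N by lia.
have nM v : v = vMid w -> ~~ inV n v by move=> -> /=; lia.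
have [ea ex] : a = vMid w /\ (x = (ends w).1 \/ x = (ends w).2).
  move: wxa => /=; case: ifP => _ [] [e1 e2].
  - by split; [|left].
  - by have := nM x (esym e2); rewrite hx.
  - by have := nM x (esym e1); rewrite hx.
  - by split; [|right].
case: p sp hp hl => [|b p] /= sp.
  by move=> _ ey; have := nM _ ea; rewrite ey hy.
move=> /andP[/adjP[w2 sw2 wab] hp] hl.
case: w2 sw2 wab => // j w2 [sw2] wab.
have sw2n : (size w2 <= n)%N by lia.
have /andP[i1 i2] := ends_inV sw2n.
have [e12 eb] : w = w2 /\ (b = (ends w2).1 \/ b = (ends w2).2).
  have nA v : inV n v -> v = a -> False by move=> + va; rewrite va ea /=; lia.
  move: wab => /=; case: ifP => _ [] [e1 e2].
  - by case: (nA _ i1 e1).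
  - by split; [move: e2; rewrite ea => -[]|left].
  - by split; [move: e1; rewrite ea => -[]|right].
  - by case: (nA _ i2 e2).
subst w2; have hb : inV n b by case: eb => ->.
have [|q hq sq] := IH b p _ hb hy (conj hp hl); first by lia.
have [xb|xb] := eqVneq x b.
  by exists q; [rewrite xb|lia].
exists (b :: q); last by rewrite /=; lia.
case: hq => hq1 hq2; split => //=; rewrite hq1 andbT; apply/adjP.
exists w => //; move: xb; rewrite (surjective_pairing (ends w)).
by case: ex => ->; case: eb => ->; rewrite ?eqxx// => _; [left|right].
Qed.

Section graph_dist_theory.
Context (R : realType).
Local Notation gd := (graph_dist R).

Lemma graph_dist_has_lb n x y :
  has_lbound [set ((size p)%:R / 2 ^+ n : R) | p in walk n x y].
Proof. by exists 0 => _ [p _ <-]; rewrite divr_ge0// exprn_ge0. Qed.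

Lemma graph_dist_le n x y p : walk n x y p -> gd n x y <= (size p)%:R / 2 ^+ n.
Proof. by move=> hp; apply: ge_inf; [exact: graph_dist_has_lb|exists p]. Qed.

Lemma le_graph_dist n x y r : inV n x -> inV n y ->
  (forall p, walk n x y p -> r <= (size p)%:R / 2 ^+ n) -> r <= gd n x y.
Proof.
move=> hx hy h; apply: lb_le_inf; last by move=> _ [p /h hp <-].
by have [p hp] := walk_ex hx hy; exists ((size p)%:R / 2 ^+ n), p.
Qed.

Lemma graph_distS n x y : inV n x -> inV n y -> gd n.+1 x y = gd n x y.
Proof.
move=> hx hy; have nS : (n <= n.+1)%N by [].
apply/eqP; rewrite eq_le; apply/andP; split.
  apply: le_graph_dist => // p /walk_up[q /graph_dist_le hq sq].
  apply: (le_trans hq); rewrite sq natrM exprS -mulf_div divff ?mul1r//.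
apply: le_graph_dist; [exact: inVS hx|exact: inVS hy|].
move=> p /(walk_down hx hy)[q /graph_dist_le hq sq].
apply: (le_trans hq).
rewrite ler_pdivrMr ?exprn_gt0// exprS invfM !mulrA mulfVK ?expf_neq0//.
by rewrite ler_pdivlMr// -natrM ler_nat mulnC.
Qed.

Lemma graph_dist_mono n m x y : (n <= m)%N -> inV n x -> inV n y ->
  gd m x y = gd n x y.
Proof.
move=> /subnKC <- hx hy; elim: (m - n)%N => [|k IH]; first by rewrite addn0.
by rewrite addnS graph_distS ?IH//; [exact: (inVS (leq_addr _ _) hx)|exact: (inVS (leq_addr _ _) hy)].
Qed.

Lemma inV_level n v : (level v <= n)%N = inV n v.
Proof. by case: v. Qed.

Lemma std_distE n x y : inV n x -> inV n y -> std_dist R (x, y) = gd n x y.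
Proof.
move=> hx hy; rewrite /std_dist /=; apply/esym/graph_dist_mono.
- by rewrite geq_max !inV_level hx.
- by rewrite -inV_level leq_maxl.
- by rewrite -inV_level leq_maxr.
Qed.

End graph_dist_theory.

Definition is_metric (R : realType) (d : Vinf * Vinf -> R) : Prop :=
  [/\ forall x, d (x, x) = 0,
      forall x y, d (x, y) = 0 -> x = y,
      forall x y, d (x, y) = d (y, x)
    & forall y x z, d (x, z) <= d (x, y) + d (y, z)].

Lemma std_dist_metric (R : realType) : is_metric (@std_dist R).
Proof.
have lv3 x y z : exists n, [/\ inV n x, inV n y & inV n z].
  by exists (maxn (level x) (maxn (level y) (level z))); split;
    rewrite -inV_level !leq_max leqnn ?orbT.
have ge0 n x y : inV n x -> inV n y -> 0 <= graph_dist R n x y.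
  by move=> hx hy; apply: le_graph_dist => // p _; rewrite divr_ge0// exprn_ge0.
have sy n x y : inV n x -> inV n y -> graph_dist R n x y <= graph_dist R n y x.
  move=> hx hy; apply: le_graph_dist => // p /walk_rev/graph_dist_le.
  by move=> /(_ R); rewrite size_rev size_belast.
split.
- move=> x; have [n [hx _ _]] := lv3 x x x; rewrite (std_distE _ hx hx).
  apply/eqP; rewrite eq_le ge0// andbT.
  have /graph_dist_le : walk n x x [::] by [].
  by move=> /(_ R); rewrite mul0r.
- move=> x y; have [n [hx hy _]] := lv3 x y x; rewrite (std_distE _ hx hy).
  move=> h0; apply: contrapT => xy; suff : 1 / 2 ^+ n <= graph_dist R n x y.
    by rewrite h0 leNgt divr_gt0// exprn_gt0.
  apply: le_graph_dist => // -[[_ /= /xy//]|a p _ /=].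
  by rewrite ler_pM2r ?invr_gt0 ?exprn_gt0// ler1n.
- move=> x y; have [n [hx hy _]] := lv3 x y x.
  by rewrite !(@std_distE _ n)//; apply/eqP; rewrite eq_le !sy.
- move=> y x z; have [n [hx hy hz]] := lv3 x y z.
  rewrite !(@std_distE _ n)// -lerBlDr; apply: le_graph_dist => // p hp.
  rewrite lerBlDl -lerBlDr; apply: le_graph_dist => // q hq.
  rewrite lerBlDl addrC -mulrDl -natrD addnC -size_cat.
  exact: graph_dist_le (walk_cat hp hq).
Qed.

(* A complete metric space containing [V_infty] as a dense subset is determined
   by the metric it induces on [V_infty], and every metric on [V_infty] arises
   in this way, from its completion (see [completion] below); hence the space of
   all such spaces is the space of metrics on [V_infty], here with the topology
   of pointwise convergence and its Borel sigma-algebra. *)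
Definition metrics (R : realType) : Type :=
  set_type [set d : {ptws Vinf * Vinf -> R} | is_metric d].

Section metrics_instances.
Context (R : realType).

Definition mkMetric (d : Vinf * Vinf -> R) (dm : is_metric d) : metrics R :=
  exist _ d (mem_set dm).

HB.instance Definition _ := Topological.copy (metrics R)
  (set_type [set d : {ptws Vinf * Vinf -> R} | is_metric d]).
HB.instance Definition _ :=
  isPointed.Build (metrics R) (mkMetric (std_dist_metric R)).
HB.instance Definition _ := Measurable.copy (metrics R)
  (@g_sigma_algebraType (metrics R) (@open (metrics R))).

Definition mval (d : metrics R) : Vinf * Vinf -> R := val d.

Lemma mvalP (d : metrics R) : is_metric (mval d).
Proof. exact: set_mem (valP d). Qed.

End metrics_instances.

(* Realised by Kuratowski's embedding, as the closure of
   [{d (v, _) | v in V_infty}] for the uniform distance. *)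
Definition in_closure (R : realType) (d : metrics R) (f : Vinf -> R) : bool :=
  `[< forall e, 0 < e -> exists v, forall w, `|f w - mval d (v, w)| <= e >].

Definition completion (R : realType) (d : metrics R) : Type :=
  {f : Vinf -> R | in_closure d f}.

Section completion_theory.
Context (R : realType) (d : metrics R).

HB.instance Definition _ := Choice.copy (completion d) {f : Vinf -> R | in_closure d f}.

Definition cval (f : completion d) : Vinf -> R := val f.

Lemma cvalP (f : completion d) e : 0 < e ->
  exists v, forall w, `|cval f w - mval d (v, w)| <= e.
Proof. by move=> e0; have /asboolP/(_ _ e0) := valP f. Qed.

Lemma mval_ge0 x y : 0 <= mval d (x, y).
Proof.
have [d0 _ ds dt] := mvalP d.
by have := dt y x x; rewrite d0 (ds y x) -mulr2n pmulrn_lge0.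
Qed.

Lemma mval_lip x y w : `|mval d (x, w) - mval d (y, w)| <= mval d (x, y).
Proof.
have [_ _ ds dt] := mvalP d; have := dt y x w; have := dt x y w.
by rewrite (ds y x) ler_norml => ? ?; apply/andP; split; lra.
Qed.

Definition cdist (f g : completion d) : R :=
  sup [set `|cval f v - cval g v| | v in [set: Vinf]].

Lemma cdist_has_ub (f g : completion d) :
  has_ubound [set `|cval f v - cval g v| | v in [set: Vinf]].
Proof.
have [v hv] := cvalP f ltr01; have [v' hv'] := cvalP g ltr01.
exists (2 + mval d (v, v')) => _ [w _ <-].
have := hv w; have := hv' w; have := mval_lip v v' w.
rewrite !ler_norml => /andP[? ?] /andP[? ?] /andP[? ?].
by apply/andP; split; lra.
Qed.

Lemma cdist_ub (f g : completion d) v : `|cval f v - cval g v| <= cdist f g.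
Proof. by apply: ub_le_sup; [exact: cdist_has_ub|exists v]. Qed.

Lemma cdist_le (f g : completion d) r :
  (forall v, `|cval f v - cval g v| <= r) -> cdist f g <= r.
Proof.
move=> h; apply: ge_sup; first by exists `|cval f vI - cval g vI|, vI.
by move=> _ [v _ <-].
Qed.

Lemma cdistxx f : cdist f f = 0.
Proof.
apply/eqP; rewrite eq_le (le_trans _ (cdist_ub f f vI)) ?normr_ge0// andbT.
by apply: cdist_le => v; rewrite subrr normr0.
Qed.

Lemma cdist_positivity f g : cdist f g = 0 -> f = g.
Proof.
move=> fg0; apply/val_inj/funext => v; apply/eqP; rewrite -subr_eq0 -normr_le0.
by rewrite -fg0; exact: cdist_ub.
Qed.

Lemma cdist_sym f g : cdist f g = cdist g f.
Proof.
by congr sup; apply: eq_imagel => v _; rewrite distrC.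
Qed.

Lemma cdist_triangle g f h : cdist f h <= cdist f g + cdist g h.
Proof.
apply: cdist_le => v; rewrite -(subrKA (cval g v)).
by rewrite (le_trans (ler_normD _ _))// lerD// cdist_ub.
Qed.

HB.instance Definition _ := isMetric.Build R (completion d)
  cdistxx cdist_positivity cdist_sym cdist_triangle.

Lemma inclV_subproof v : in_closure d (fun w => mval d (v, w)).
Proof.
by apply/asboolP => e e0; exists v => w; rewrite subrr normr0 ltW.
Qed.

Definition inclV (v : Vinf) : completion d :=
  exist _ (fun w => mval d (v, w)) (inclV_subproof v).

Lemma inclV_isometry x y : mdist (inclV x) (inclV y) = mval d (x, y).
Proof.
have [d0 _ _ _] := mvalP d.
apply/eqP; rewrite eq_le; apply/andP; split.
  by apply: cdist_le => w; exact: mval_lip.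
by have := cdist_ub (inclV x) (inclV y) y; rewrite /cval/= d0 subr0 ger0_norm ?mval_ge0.
Qed.

Lemma inclV_dense (f : completion d) e : 0 < e ->
  exists v, mdist f (inclV v) <= e.
Proof. by move=> /(cvalP f)[v hv]; exists v; exact: cdist_le. Qed.

HB.instance Definition _ := isPointed.Build (completion d) (inclV vI).

Lemma completion_complete (F : set_system (completion d)) :
  ProperFilter F -> cauchy F -> cvg F.
Proof.
move=> FF /cauchyP Fc.
have Fb e : 0 < e -> exists z, \forall f \near F, cdist z f < e.
  by move=> e0; have [z] := Fc e e0; rewrite ballEmdist; exists z.
have Fw w : cvg ((fun f => cval f w) @ F).
  apply: cauchy_cvg; apply/cauchyP => e e0; have [z hz] := Fb e e0.
  exists (cval z w); apply: filterS hz => f; apply: le_lt_trans.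
  exact: cdist_ub.
pose l w := lim ((fun f => cval f w) @ F).
have lE e z : (\forall f \near F, cdist z f < e) ->
    forall w, `|l w - cval z w| <= e.
  move=> hz w; apply/ler_addgt0Pr => e' e'0.
  have hl : \forall f \near F, `|l w - cval f w| <= e'.
    by move/cvgrPdist_le : (Fw w) => /(_ e' e'0).
  have [f [h1 h2]] := filter_ex (filterI hz hl).
  have h3 := le_trans (cdist_ub z f w) (ltW h1).
  have -> : l w - cval z w = (l w - cval f w) - (cval z w - cval f w) by ring.
  by rewrite (le_trans (ler_normB _ _))// addrC lerD.
have lcl : in_closure d l.
  apply/asboolP => e e0; have e20 : 0 < e / 2 by rewrite divr_gt0.
  have [z /lE hz] := Fb _ e20; have [v hv] := cvalP z e20.
  exists v => w; rewrite -(subrKA (cval z w)) (splitr e).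
  by rewrite (le_trans (ler_normD _ _))// lerD.
apply/cvg_ex; exists (exist _ l lcl : completion d).
apply/cvg_ballP => e e0; have e20 : 0 < e / 2 by rewrite divr_gt0.
have [z hz] := Fb _ e20.
apply: filterS (hz) => f hf; rewrite ballEmdist /= (splitr e).
apply: le_lt_trans (cdist_triangle z _ _) _.
by apply: ler_ltD => //; apply: cdist_le; exact: lE.
Qed.

HB.instance Definition _ :=
  Uniform_isComplete.Build (completion d) completion_complete.

End completion_theory.

(* A chain from [x] to [y] is a sequence of steps [(i, a, b)], each of them
   going from [a] to [b] inside the [i]-th space. *)
Fixpoint chain (x : Vinf) (s : seq ('I_4 * Vinf * Vinf)) (y : Vinf) : Prop :=
  match s with
  | [::] => x = y
  | t :: s' => x = copy t.1.1 t.1.2 /\ chain (copy t.1.1 t.2) s' y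
  end.

Section glue.
Context (R : realType) (d : 'I_4 -> metrics R).

Definition cost (s : seq ('I_4 * Vinf * Vinf)) : R :=
  \sum_(t <- s) mval (d t.1.1) (t.1.2, t.2).

Definition glue (xy : Vinf * Vinf) : R :=
  inf [set cost s | s in [set s | chain xy.1 s xy.2]].

Lemma cost_ge0 s : 0 <= cost s.
Proof. by apply: sumr_ge0 => t _; exact: mval_ge0. Qed.

Lemma glue_le x y s : chain x s y -> glue (x, y) <= cost s.
Proof.
move=> h; apply: ge_inf; last by exists s.
by exists 0 => _ [s' _ <-]; exact: cost_ge0.
Qed.

Lemma copy_surj x : exists i a, x = copy i a.
Proof.
case: x => [||w]; first by exists ord0, vI.
  by exists ord_max, vO.
case/lastP: w => [|w i]; first by exists ord0, vO.
by exists i, (vMid w).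
Qed.

Lemma copy_inj i : injective (copy i).
Proof.
move=> [||w] [||w'] //=; try (case: ifP => _ //=).
all: try by case: w.
all: try by case: w'.
by move=> [/rcons_inj[->]].
Qed.

Lemma chain_cat x y z s t : chain x s y -> chain y t z -> chain x (s ++ t) z.
Proof. by elim: s x => [|u s IH] x /= => [->//|[-> /IH h] /h]. Qed.

Lemma cost_cat s t : cost (s ++ t) = cost s + cost t.
Proof. by rewrite /cost big_cat. Qed.

Lemma chain_rev x y s : chain x s y ->
  exists2 t, chain y t x & cost t = cost s.
Proof.
elim: s x => [|[[i a] b] s IH] x /= => [->|[-> /IH[t ht ct]]]; first by exists [::].
exists (t ++ [:: (i, b, a)]); first by apply: chain_cat ht _.
rewrite cost_cat ct /cost !big_cons big_nil /= addr0 addrC.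
by have [_ _ -> _] := mvalP (d i).
Qed.

Lemma corner_chain i a : exists s, chain (copy i a) s vI \/ chain (copy i a) s (vMid [::]).
Proof.
exists [:: (i, a, vI)]; rewrite /=.
by case: ifP => _; [left|right].
Qed.

Lemma chain_ex x y : exists s, chain x s y.
Proof.
suff h z : exists s, chain z s vI.
  have [s hs] := h x; have [t /chain_rev[t' ht' _]] := h y.
  by exists (s ++ t'); exact: chain_cat hs ht'.
have [i [a ->]] := copy_surj z; have [s [hs|hs]] := corner_chain i a.
  by exists s.
by exists (s ++ [:: (ord0, vO, vI)]); apply: chain_cat hs _.
Qed.

Lemma le_glue x y r : (forall s, chain x s y -> r <= cost s) -> r <= glue (x, y).
Proof.
move=> h; apply: lb_le_inf; last by move=> _ [s /h hs <-].
by have [s hs] := chain_ex x y; exists (cost s), s.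
Qed.

Lemma glue_lip (phi : Vinf -> R) :
  (forall i a b, phi (copy i b) - phi (copy i a) <= mval (d i) (a, b)) ->
  forall x y, phi y - phi x <= glue (x, y).
Proof.
move=> h x y; apply: le_glue => s; elim: s x => [|[[i a] b] s IH] x /=.
  by move=> ->; rewrite subrr cost_ge0.
move=> [-> /IH hs]; rewrite /cost big_cons /=.
rewrite -(subrKA (phi (copy i b))) addrC lerD//.
Qed.

Lemma mval_gt0 (e : metrics R) x y : x <> y -> 0 < mval e (x, y).
Proof.
move=> xy; rewrite lt_neqAle mval_ge0 andbT; apply/eqP => h.
by have [_ dp _ _] := mvalP e; apply/xy/dp.
Qed.

Lemma glue_pos x y : x <> y -> 0 < glue (x, y).
Proof.
move=> xy.
pose pre i : option Vinf :=
  if pselect (exists b, copy i b = x) is left h then Some (sval (cid h)) else None.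
have preP i b : pre i = Some b <-> copy i b = x.
  rewrite /pre; case: pselect => [h|h].
    case: cid => b' /= hb'; split=> [[<-]//|]; rewrite -hb'.
    by move=> /copy_inj ->.
  by split=> // hb; case: h; exists b.
pose g i (c : Vinf) : R := if pre i is Some b then
  (if c == b then 1 else mval (d i) (c, b)) else 1.
have g0 i c : 0 < g i c.
  rewrite /g; case: (pre i) => [b|//]; case: eqVneq => // cb.
  by apply/mval_gt0/eqP.
pose del : R := \big[Num.min/1]_(i < 4) Num.min (g i vI) (g i vO).
have del0 : 0 < del.
  by apply: lt_bigmin => // i _; rewrite lt_min !g0.
have delm i : del <= Num.min (g i vI) (g i vO) by exact: bigmin_le_cond.
have delI i : del <= g i vI.
  by apply: le_trans (delm i) _; rewrite ge_min lexx.
have delO i : del <= g i vO.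
  by apply: le_trans (delm i) _; rewrite ge_min lexx orbT.
pose f i a : R := if pre i is Some b then Num.min del (mval (d i) (a, b)) else del.
pose corner v : R := if v == x then 0 else del.
pose phi v : R := match v with
  | vMid w => match rev w with i :: w' => f i (vMid (rev w')) | [::] => corner v end
  | _ => corner v end.
have fc i c : c = vI \/ c = vO -> f i c = corner (copy i c).
  move=> hc; rewrite /f /corner; case: eqP => [/preP ->|ne].
    by have [-> _ _ _] := mvalP (d i); rewrite min_r// ltW.
  case e : (pre i) => [b|//]; apply: min_l.
  have cb : c <> b by move=> cb; apply: ne; apply/preP; rewrite cb.
  have := delI i; have := delO i; rewrite /g e.
  by case: hc cb => -> /eqP/negPf ->.
have phiE i a : phi (copy i a) = f i a.
  case: a => [||w]; last by rewrite /= rev_rcons revK.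
    by rewrite fc; [rewrite /=; case: ifP|left].
  by rewrite fc; [rewrite /=; case: ifP|right].
have phix : phi x = 0.
  have [i [a xa]] := copy_surj x; rewrite xa phiE /f.
  have /preP -> := esym xa; have [-> _ _ _] := mvalP (d i).
  by rewrite min_r// ltW.
have phiy : 0 < phi y.
  have [i [a ya]] := copy_surj y; rewrite ya phiE /f.
  case e : (pre i) => [b|//]; rewrite lt_min del0 /=; apply: mval_gt0 => ab.
  by apply: xy; rewrite ya ab; apply/esym/preP.
rewrite (lt_le_trans phiy)// -[leLHS]subr0 -phix; apply: glue_lip => i a b.
rewrite !phiE /f; case: (pre i) => [c|]; last by rewrite subrr mval_ge0.
have [_ _ ds dt] := mvalP (d i); have h1 := mval_ge0 (d i) a b.
have := dt a b c; rewrite (ds b a) => h2.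
rewrite lerBlDr; have [h|h] := leP del (mval (d i) (a, c)).
  by rewrite ge_min lerDr h1.
by rewrite ge_min h2 orbT.
Qed.

Lemma glue_metric : is_metric glue.
Proof.
have sy x y : glue (x, y) <= glue (y, x).
  by apply: le_glue => s /chain_rev[t /glue_le ht <-].
have g0 x y : 0 <= glue (x, y) by apply: le_glue => s _; exact: cost_ge0.
split.
- move=> x; apply/eqP; rewrite eq_le g0 andbT.
  have /glue_le : chain x [::] x by [].
  by rewrite /cost big_nil.
- by move=> x y h; apply: contrapT => /glue_pos; rewrite h ltxx.
- by move=> x y; apply/eqP; rewrite eq_le !sy.
- move=> y x z; rewrite -lerBlDr; apply: le_glue => s hs.
  rewrite lerBlDl -lerBlDr; apply: le_glue => t ht.
  rewrite lerBlDl -cost_cat; exact: glue_le (chain_cat hs ht).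
Qed.

End glue.

Definition posreals (R : realType) : Type := set_type [set x : R | 0 < x].

Section posreals_instances.
Context (R : realType).

Definition PosReal (x : R) (x0 : 0 < x) : posreals R := exist _ x (mem_set x0).

HB.instance Definition _ :=
  Topological.copy (posreals R) (set_type [set x : R | 0 < x]).
HB.instance Definition _ := isPointed.Build (posreals R) (PosReal ltr01).
HB.instance Definition _ := Measurable.copy (posreals R)
  (@g_sigma_algebraType (posreals R) (@open (posreals R))).

Definition rval (x : posreals R) : R := val x.

Lemma rval_gt0 (x : posreals R) : 0 < rval x.
Proof. exact: set_mem (valP x). Qed.

Lemma measurable_rval : measurable_fun setT rval.
Proof.
apply: (@measurability _ _ (posreals R) (measurableTypeR R) setT rval
  _ (RGenOpens.measurableE R)) => _ [_ [a [b ->]] <-].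
rewrite setTI; apply: sub_sigma_algebra.
by exists `]a, b[%classic => //; exact: interval_open.
Qed.

Definition pos_expR (x : measurableTypeR R) : posreals R :=
  PosReal (expR_gt0 (x : R)).

Lemma measurable_pos_expR : measurable_fun [set: measurableTypeR R] pos_expR.
Proof.
apply: (@measurability _ _ _ _ _ _ (@open (posreals R))) => // _ [_ [B oB <-] <-].
rewrite setTI; apply: open_measurable.
by apply: (open_comp _ oB) => x _; exact: continuous_expR.
Qed.

HB.instance Definition _ := isMeasurableFun.Build _ _ _ _ pos_expR
  measurable_pos_expR.

End posreals_instances.

(* [sigma] is the standard deviation of the underlying normal law. *)
Definition lognormal (R : realType) (sigma : R) : probability (posreals R) R :=
  distribution (normal_prob 0 sigma) (@pos_expR R).

Section renormalization.
Context (R : realType).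

Definition quad (T : Type) (p : T * T * T * T) (i : 'I_4) : T :=
  nth p.2 [:: p.1.1.1; p.1.1.2; p.1.2; p.2] i.

Lemma scale_metric (c : R) (d : Vinf * Vinf -> R) :
  0 < c -> is_metric d -> is_metric (fun xy => c * d xy).
Proof.
move=> c0 [d0 dp ds dt]; split=> [x|x y|x y|y x z].
- by rewrite d0 mulr0.
- by move=> /eqP; rewrite mulf_eq0 gt_eqF//= => /eqP/dp.
- by rewrite ds.
- by rewrite -mulrDr ler_pM2l.
Qed.

(* The glued metric is only taken between points of [V_infty]; this loses
   nothing, as the glueing points belong to [V_infty]. *)
Definition Rlambda (l : posreals R)
    (p : metrics R * metrics R * metrics R * metrics R * posreals R) :
    metrics R :=
  mkMetric (scale_metric (mulr_gt0 (rval_gt0 l) (rval_gt0 p.2))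
    (glue_metric (quad p.1))).

Local Open Scope ereal_scope.

Definition Phi (l : posreals R) (m : probability (posreals R) R)
    (mb : probability (metrics R) R) : set (metrics R) -> \bar R :=
  pushforward ((((mb \x mb) \x mb) \x mb) \x m) (Rlambda l).

Definition radon (mb : probability (metrics R) R) : Prop :=
  forall A, measurable A ->
    mb A = ereal_sup [set mb K | K in [set K | compact K /\ K `<=` A]].

Definition stationary_random_metric (l : posreals R)
    (m : probability (posreals R) R) (mb : probability (metrics R) R) : Prop :=
  radon mb /\ forall A, measurable A -> Phi l m mb A = mb A.

Definition non_atomic (mb : probability (metrics R) R) : Prop :=
  forall d, mb [set d] = 0.

Definition Rmin (l : posreals R)
    (p : \bar R * \bar R * \bar R * \bar R * posreals R) : \bar R :=
  (rval l * rval p.2)%:E *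
  (mine p.1.1.1.1 p.1.1.1.2 + mine p.1.1.2 p.1.2).

Definition cutoff (A : R) (l : posreals R)
    (p : \bar R * \bar R * \bar R * \bar R * posreals R) : \bar R :=
  mine (Rmin l p) A%:E.

Lemma measurable_cutoff A l : measurable_fun setT (cutoff A l).
Proof.
pose T : measurableType _ :=
  (\bar R * \bar R * \bar R * \bar R * posreals R)%type.
have m1 : measurable_fun setT (fun p : T => p.1) by exact: measurable_fst.
have m2 := measurableT_comp measurable_fst m1.
have m3 := measurableT_comp measurable_fst m2.
apply: measurable_mine => //; apply: emeasurable_funM.
  apply/measurable_EFinP/measurable_funM => //.
  exact: measurableT_comp (@measurable_rval R) measurable_snd.
apply: emeasurable_funD; apply: measurable_mine.
- exact: measurableT_comp measurable_fst m3.
- exact: measurableT_comp measurable_snd m3.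
- exact: measurableT_comp measurable_snd m2.
- exact: measurableT_comp measurable_snd m1.
Qed.

HB.instance Definition _ A l := isMeasurableFun.Build _ _ _ _ (cutoff A l)
  (measurable_cutoff A l).

(* The laws on [0, +oo] are seen as laws on [\bar R]; all those considered below
   are images of [\d_ +oo] and do not charge the negative values. *)
Definition PhiA (A : R) (l : posreals R) (m : probability (posreals R) R)
    (mu : probability (\bar R) R) : probability (\bar R) R :=
  distribution ((((mu \x mu) \x mu) \x mu) \x m) (cutoff A l).

Definition weak_cvg (mu : nat -> probability (\bar R) R)
    (nu : probability (\bar R) R) : Prop :=
  forall f : \bar R -> R, continuous f -> (exists M, forall x, `|f x| <= M)%R ->
    \int[mu n]_x (f x)%:E @[n --> \oo] --> \int[nu]_x (f x)%:E.

(* [nu] is the measure [nu_{A, lambda}]. *)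
Definition is_nu (A : R) (l : posreals R) (m : probability (posreals R) R)
    (nu : probability (\bar R) R) : Prop :=
  weak_cvg (fun n => iter n (PhiA A l m) (\d_ +oo : probability (\bar R) R)) nu.

Definition Lambda (A : R) (m : probability (posreals R) R) : set R :=
  [set rval l | l in [set l | exists nu, is_nu A l m nu /\
    exists2 B, measurable B & nu B <> \d_ (0 : \bar R) B]].

Definition lambda_cr (A : R) (m : probability (posreals R) R) : R :=
  inf (Lambda A m).

End renormalization.

Section metric_notions.
Context (R : realType) (T : metricType R).
Local Open Scope ereal_scope.

(* Adding [0] only matters for the empty set, whose diameter is [0]. *)
Definition diam (A : set T) : \bar R :=
  ereal_sup (0 |` [set (mdist xy.1 xy.2)%:E | xy in A `*` A]).

Definition hausdorff_premeasure (s delta : R) (A : set T) : \bar R :=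
  ereal_inf [set \sum_(0 <= i <oo) diam (U i) `^ s |
    U in [set U : nat -> set T |
      A `<=` \bigcup_i U i /\ forall i, diam (U i) <= delta%:E]].

Definition hausdorff_measure (s : R) (A : set T) : \bar R :=
  ereal_sup [set hausdorff_premeasure s delta A |
    delta in [set delta | (0 < delta)%R]].

Definition hausdorff_dim (A : set T) : \bar R :=
  ereal_inf [set s%:E | s in
    [set s | (0 < s)%R /\ hausdorff_measure s A = 0]].

End metric_notions.

Definition homeomorphism (S T : topologicalType) (f : S -> T) : Prop :=
  exists g : T -> S, [/\ continuous f, continuous g, cancel f g & cancel g f].

Definition std_metric (R : realType) : metrics R := mkMetric (std_dist_metric R).

Definition Gamma_infty (R : realType) : Type := completion (std_metric R).

Definition gamma_BRW (R : realType) (sigma : R) : R :=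
  Num.sqrt (2 * ln 4) * sigma.

(* Main.v *)
Require Import Defs.
From HB Require Import structures.
From mathcomp Require Import all_boot all_order all_algebra.
From mathcomp Require Import all_classical all_reals all_analysis.
From mathcomp Require Import measurable_realfun zify ring lra.

Set Implicit Arguments.
Unset Strict Implicit.
Unset Printing Implicit Defensive.

Import Order.TTheory GRing.Theory Num.Theory.
Import numFieldNormedType.Exports.

Local Open Scope classical_set_scope.
Local Open Scope ring_scope.

(** Write c = gamma_BRW + log lambda. Both regimes are read off from the
    stationarity equation alone, one generation at a time.

    If c < 0, let X be the distance from I to O. It satisfies
    X <= lambda xi (min(X_1, X_2) + min(X_3, X_4)), and since a minimum of two
    independent variables is large only if both are, X has all the moments that
    xi has ([stationary_moment]). The sum of the s-th powers of the lengths of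
    the 4^n edges of generation n then has an expectation at most C rho^n with
    rho = 4 E[(lambda xi)^s] ([integral_edge_sumS]), and for
    s = sqrt (2 log 4) / sigma this rho is exp (s c) ([lognormal_moment]). So
    almost surely the edges of generation n have length at most C r^n, for every
    r > exp c ([stationary_decay]). By chaining, cells of generation n have a
    diameter of the same order ([decay_cell]). Covering the space with the 4^n
    cells gives the bound log 4 / |c| on the Hausdorff dimension
    ([hausdorff_measure_decay0]), and small cells make the inclusion of V_infty
    uniformly continuous for the standard metric. Conversely, an edge separates
    its cell from the rest of the space, a property that glueing preserves
    ([separates_glue]) and which holds almost surely by stationarity
    ([stationary_separates]); as there are finitely many vertices in a given
    generation, points of distant cells stay at a distance bounded below, so the
    inverse is uniformly continuous too ([separates_unif_continuous],
    [unif_equiv_homeomorphism]).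

    If c > 0, consider the distance of a point to the pair of glueing points I
    and O. A path from inside the i-th copy to I or O has to reach the boundary
    of that copy, so the supremum S of these distances satisfies
    S >= lambda xi max(S_1, .., S_4). Hence the tail g(y) = P(S > exp y) is a
    supersolution of a branching recursion with Gaussian steps of drift
    log lambda ([tall_supersolution]); its linearisation at 0 has the growth
    factor 4 exp (- a^2 / (2 sigma^2)), with a the drift, which is larger than 1
    exactly because c > 0 ([supercritical_drift]). An explicit compactly
    supported subsolution ([normal_bump]) can therefore be amplified below g up
    to a height that does not depend on where it is placed, so g is bounded below
    ([tall_uniform_lower_bound]) and S is infinite with positive probability.
    Finally p = P(S < oo) satisfies p <= p^4, which leaves p = 0
    ([supercritical_unbounded]). *)

(** * Cells of the hierarchical graph *)

Definition corner (w : seq 'I_4) (v : Vinf) : Prop :=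
  v = (ends w).1 \/ v = (ends w).2.

(** The points created inside the edge [w]: as the latest replacement comes
    first in a word, these are the points whose word ends with [w]. *)
Definition inner (w : seq 'I_4) (v : Vinf) : Prop := exists u, v = vMid (u ++ w).

Definition cell (w : seq 'I_4) (v : Vinf) : Prop := corner w v \/ inner w v.

Lemma corner_rcons w i v :
  corner (rcons w i) v <-> exists2 v', corner w v' & v = copy i v'.
Proof.
rewrite /corner ends_rcons /=; split=> [[->|->]|[v' [->|->] ->]]; [| |by left|by right].
- by exists (ends w).1; [left|].
- by exists (ends w).2; [right|].
Qed.

Lemma copy_inner j p i w u : copy j p = vMid (u ++ rcons w i) ->
  j = i /\ p = vMid (u ++ w).
Proof.
rewrite -rcons_cat; case: p => [||w'] /=.
- by case: ifP => // _ []; case: (u ++ w).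
- by case: ifP => // _ []; case: (u ++ w).
- by move=> [/rcons_inj[-> ->]].
Qed.

Lemma inner_rcons w i v :
  inner (rcons w i) v <-> exists2 v', inner w v' & v = copy i v'.
Proof.
split=> [[u ->]|[_ [u ->] ->]]; last by exists u; rewrite /= rcons_cat.
by exists (vMid (u ++ w)); [exists u|rewrite /= rcons_cat].
Qed.

Lemma cell_rcons w i v :
  cell (rcons w i) v <-> exists2 v', cell w v' & v = copy i v'.
Proof.
rewrite /cell corner_rcons inner_rcons; split.
  by move=> [[v' h ->]|[v' h ->]]; exists v' => //; [left|right].
by move=> [v' [h|h] ->]; [left|right]; exists v'.
Qed.

Lemma cell_cover n v : exists2 w, size w = n & cell w v.
Proof.
elim: n => [|n [w sw [[->|->]|[u ->]]]].
- exists [::] => //; case: v => [||u]; [by left; left|by left; right|right].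
  by exists u; rewrite cats0.
- by exists (ord0 :: w); rewrite /= ?sw//; left; left.
- by exists (ord_max :: w); rewrite /= ?sw//; left; right.
- case/lastP: u => [|u i]; first by exists (ord0 :: w); rewrite /= ?sw//; left; right.
  by exists (i :: w); rewrite /= ?sw//; right; exists u; rewrite cat_rcons.
Qed.

Lemma inner_ends_suffix w v : inner w (ends v).1 \/ inner w (ends v).2 ->
  exists u', v = u' ++ w.
Proof.
elim: v => [|i v IH] /=; first by move=> [] [u'].
have aux : inner w (vMid v) -> exists u', i :: v = u' ++ w.
  by move=> [u' [->]]; exists (i :: u').
have aux2 : inner w (ends v).1 \/ inner w (ends v).2 -> exists u', i :: v = u' ++ w.
  by move=> /IH[u' ->]; exists (i :: u').
by case: ifP => _ /= [h|h]; [apply: aux2; left|exact: aux|exact: aux|apply: aux2; right].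
Qed.

Lemma cell_ends_cat u w : cell w (ends (u ++ w)).1 /\ cell w (ends (u ++ w)).2.
Proof.
elim: u => [|i u [IH1 IH2]] /=; first by split; left; [left|right].
have h : cell w (vMid (u ++ w)) by right; exists u.
by case: ifP.
Qed.

Lemma corner_not_inner w w' v : size w = size w' -> corner w v -> ~ inner w' v.
Proof.
move=> sw wv [u vE]; have /andP[] := @ends_inV (size w) w (leqnn _).
by case: wv => <-; rewrite vE /= size_cat => ?; lia.
Qed.

Section separation.
Context (R : realType).
Implicit Types (d : Vinf * Vinf -> R) (w : seq 'I_4).

(** The cell of [w] is attached to the rest of the space by the two endpoints
    of [w] only, so a geodesic leaving the cell passes through one of them. This
    is what remains of the glueing once the metric alone is known, and it is what
    keeps apart the points of different cells. *)
Definition separates d w : Prop := forall x y, cell w x -> ~ inner w y ->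
  exists2 a, corner w a & d (x, a) + d (a, y) <= d (x, y).

Lemma separates_scale d w c : 0 < c -> separates d w ->
  separates (fun xy => c * d xy) w.
Proof.
move=> c0 h x y wx wy; have [a wa ha] := h x y wx wy; exists a => //.
by rewrite -mulrDr ler_pM2l.
Qed.

Lemma separates_nil d : is_metric d -> separates d [::].
Proof.
move=> [d0 _ _ _] x y _ wy; exists y; last by rewrite d0 addr0.
by case: y wy => [||u] wy; [left|right|case: wy; exists u; rewrite cats0].
Qed.

(** The endpoint used depends on the path; as there are only two endpoints,
    the smaller of the two detours is below the cost of every path. *)
Lemma separates_of_inf d w x y (P : R -> Prop) :
  (forall r, (forall c, P c -> r <= c) -> r <= d (x, y)) ->
  (forall c, P c -> exists2 a, corner w a & d (x, a) + d (a, y) <= c) ->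
  exists2 a, corner w a & d (x, a) + d (a, y) <= d (x, y).
Proof.
move=> hinf hP.
pose s a := d (x, a) + d (a, y).
have : Num.min (s (ends w).1) (s (ends w).2) <= d (x, y).
  by apply: hinf => c /hP[a [->|->] ha]; rewrite ge_min ha ?orbT.
by rewrite ge_min => /orP[h|h]; [exists (ends w).1; [left|]|exists (ends w).2; [right|]].
Qed.

(** The part of a chain that stays in the cell is absorbed by the triangle
    inequality. A chain can leave the cell, other than at an endpoint, only by a
    step inside the [i]-th space, where [w] separates by hypothesis. *)
Lemma separates_glue (d : 'I_4 -> metrics R) w i :
  separates (mval (d i)) w -> separates (Defs.glue d) (rcons w i).
Proof.
move=> hd x y wx wy; have [g0 _ _ gt] := glue_metric d.
apply: (@separates_of_inf _ _ _ _
  (fun c => exists2 s, chain x s y & c = cost d s)).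
  by move=> r h; apply: le_glue => s hs; apply: h; exists s.
move=> _ [s hs ->]; elim: s x wx hs => [|[[j p] q] s IH] x wx /=.
  move=> xy; case: wx => [cx|ix]; last by case: wy; rewrite -xy.
  by exists x => //; rewrite xy !g0 addr0 cost_ge0.
move=> [xE hs]; case: wx => [cx|[u xu]].
  by exists x => //; rewrite g0 add0r; apply: glue_le.
have [ji pE] : j = i /\ p = vMid (u ++ w).
  by apply: copy_inner; rewrite -xE.
subst j; have wp : cell w p by right; exists u.
have edge b b' : Defs.glue d (copy i b, copy i b') <= mval (d i) (b, b').
  have /(glue_le d) : chain (copy i b) [:: (i, b, b')] (copy i b') by [].
  by rewrite /cost big_seq1.
have {}hsE : Defs.glue d (copy i q, y) <= cost d s := glue_le d hs.
rewrite /cost big_cons /= -/(cost d s).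
have [wq|wq] := pselect (cell w q).
  have [|a wa ha] := IH (copy i q) _ hs; first by apply/cell_rcons; exists q.
  exists a => //; have := gt (copy i q) x a; have := edge p q.
  by rewrite xE; lra.
have [|a wa ha] := hd p q wp; first by move=> ?; apply: wq; right.
exists (copy i a); first by apply/corner_rcons; exists a.
have := gt (copy i q) (copy i a) y; have := edge p a; have := edge a q.
by rewrite xE; lra.
Qed.

(** In the graphs [Gamma_n], the neighbours of a point created inside [w]
    belong to the cell of [w], so that a walk can leave the cell only through an
    endpoint. *)
Lemma separates_std w : separates (@std_dist R) w.
Proof.
move=> x y wx wy.
pose n := maxn (size w) (maxn (level x) (level y)).
have hx : inV n x by rewrite -inV_level !leq_max leqnn !orbT.
have hy : inV n y by rewrite -inV_level !leq_max leqnn !orbT.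
have hc a : corner w a -> inV n a.
  have /andP[h1 h2] := @ends_inV n w (leq_maxl _ _).
  by case=> ->.
apply: (@separates_of_inf _ _ _ _
  (fun c => exists2 p, walk n x y p & c = (size p)%:R / 2 ^+ n)).
  by move=> r h; rewrite (std_distE _ hx hy); apply: le_graph_dist => // p hp; apply: h; exists p.
move=> _ [p hp ->].
suff [p1 [p2 [a [wa h1 h2 sp]]]] : exists p1 p2 a,
    [/\ corner w a, walk n x a p1, walk n a y p2 & size p = (size p1 + size p2)%N].
  exists a => //; rewrite !(@std_distE _ n)//; try exact: hc.
  by rewrite sp natrD mulrDl lerD// graph_dist_le.
move: (n) (hy) (hc) (p) (hp) => {hx hy hc hp p}n hy hc p; elim: p x wx => [|z p IH] x wx [/= hp hl].
  exists [::], [::], x; split=> //; case: wx => // ix.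
  by case: wy; rewrite -hl.
case: wx => [cx|ix]; first by exists [::], (z :: p), x; split.
move: hp => /andP[/[dup] xz /adjP[v _ vxz] hp].
have [u vE] : exists u, v = u ++ w.
  by apply: inner_ends_suffix => //; case: vxz => ->; [left|right].
have [c1 c2] := cell_ends_cat u w.
have wz : cell w z by move: c1 c2; rewrite -vE; case: vxz => ->.
have [p1 [p2 [a [wa [h1 h1'] h2 sp]]]] := IH z wz (conj hp hl).
exists (z :: p1), p2, a; split=> //; last by rewrite /= sp.
by split => //=; rewrite xz.
Qed.

Definition decay d C r : Prop :=
  forall w, d (ends w) <= C * r ^+ size w.

Lemma decay_std : decay (@std_dist R) 1 2^-1.
Proof.
move=> w; have /andP[h1 h2] := @ends_inV (size w) w (leqnn _).
rewrite (surjective_pairing (ends w)) (std_distE _ h1 h2) mul1r.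
have hw : walk (size w) (ends w).1 (ends w).2 [:: (ends w).2].
  split => //=; rewrite andbT; apply/adjP; exists w => //.
  by left; case: (ends w).
by rewrite (le_trans (graph_dist_le _ hw))//= div1r exprVn.
Qed.

(** Chaining: a point created inside [w] is reached from [w] by following one
    edge in each later generation, and the edge lengths form a geometric series.
    The induction closes because [r * (2 - r) <= 1]. *)
Lemma decay_cell d C r : is_metric d -> 0 <= r -> r < 1 -> 0 <= C ->
  decay d C r ->
  forall w v, cell w v -> d (v, (ends w).1) <= C * r ^+ size w / (1 - r).
Proof.
move=> [d0 _ ds dt] r0 r1 C0 hd.
have r10 : 0 < 1 - r by lra.
have hmid w : d (vMid w, (ends w).1) <= C * r ^+ (size w).+1.
  by rewrite ds; apply: (hd (ord0 :: w)).
have hCr n : 0 <= C * r ^+ n by rewrite mulr_ge0// exprn_ge0.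
have hdiv x : 0 <= x -> x <= x / (1 - r).
  by move=> x0; rewrite ler_pdivlMr// mulrBr mulr1 lerBlDr lerDl mulr_ge0.
have hS n : C * r ^+ n.+1 <= C * r ^+ n.
  by rewrite ler_wpM2l// exprS ler_piMl ?exprn_ge0// ltW.
suff hi u w : d (vMid (u ++ w), (ends w).1) <= C * r ^+ size w / (1 - r).
  move=> w v [[->|->]|[u ->]] //; first by rewrite d0 divr_ge0// ltW.
  rewrite ds -surjective_pairing; exact: le_trans (hd w) (hdiv _ (hCr _)).
elim/last_ind: u w => [|u i IH] w.
  exact: le_trans (hmid w) (le_trans (hS _) (hdiv _ (hCr _))).
rewrite cat_rcons; have := IH (i :: w).
have : d ((ends (i :: w)).1, (ends w).1) <= C * r ^+ (size w).+1.
  by rewrite /=; case: ifP => _ /=; rewrite ?d0.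
move=> h1 h2; have h3 := dt (ends (i :: w)).1 (vMid (u ++ i :: w)) (ends w).1.
apply: (le_trans h3); apply: (le_trans (lerD h2 h1)).
rewrite /= exprS; set y := r ^+ size w.
have y0 : 0 <= y by exact: exprn_ge0.
rewrite -subr_ge0.
have -> : C * y / (1 - r) - (C * (r * y) / (1 - r) + C * (r * y)) =
   C * y * (1 - r) by field; lra.
by rewrite mulr_ge0// ?mulr_ge0// ltW.
Qed.

Lemma cvg_geo_small (C r e : R) : 0 <= r -> r < 1 -> 0 < e ->
  exists n : nat, C * r ^+ n <= e.
Proof.
move=> r0 r1 e0.
have : (C * r ^+ n) @[n --> \oo] --> C * 0.
  by apply: cvgMl_tmp; apply: cvg_expr; rewrite ger0_norm.
rewrite mulr0 => /cvgrPdist_le/(_ e e0)[n _ /(_ n (leqnn n))] /=.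
by rewrite sub0r normrN => hn; exists n; exact: le_trans (ler_norm _) hn.
Qed.

Lemma finite_separation d (s : seq Vinf) : is_metric d ->
  exists2 del, 0 < del & {in s &, forall a b, a != b -> del <= d (a, b)}.
Proof.
move=> dm; have [_ dp ds dt] := dm.
have dpos a b : a != b -> 0 < d (a, b).
  by move=> ab; rewrite -[d _]/(mval (mkMetric dm) (a, b)); apply/mval_gt0/eqP.
pose f (p : Vinf * Vinf) := if p.1 == p.2 then 1 else d p.
exists (\big[Num.min/1]_(p <- [seq (a, b) | a <- s, b <- s]) f p).
  apply: lt_bigmin => //= -[a b] _; rewrite /f /=.
  by case: eqVneq => // /dpos.
move=> a b sa sb ab; have -> : d (a, b) = f (a, b) by rewrite /f /= (negPf ab).
by apply: ge_bigmin_seq => //; apply/allpairsP; exists (a, b).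
Qed.

(** Two points lying in cells of generation [n] without common endpoint are
    separated by two distinct vertices of generation at most [n], of which there
    are finitely many; their [d1]-distance is thus bounded below. Points in
    touching cells are [d2]-close since these cells are small. *)
Lemma separates_unif_continuous d1 d2 C r : is_metric d1 -> is_metric d2 ->
  (forall w, separates d1 w) -> 0 <= r -> r < 1 -> 0 <= C -> decay d2 C r ->
  forall e, 0 < e -> exists2 del, 0 < del &
    forall x y, d1 (x, y) < del -> d2 (x, y) <= e.
Proof.
move=> d1m d2m sep r0 r1 C0 hd e e0.
have [_ _ s1 t1] := d1m; have [_ _ s2 t2] := d2m.
have g1 a b : 0 <= d1 (a, b) by exact: (mval_ge0 (mkMetric d1m)).
have e40 : 0 < e / 4 by lra.
have [n hn] := cvg_geo_small (C / (1 - r)) r0 r1 e40.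
have hcell w v : size w = n -> cell w v -> d2 (v, (ends w).1) <= e / 4.
  move=> sw wv; apply: le_trans (decay_cell d2m r0 r1 C0 hd wv) _.
  by rewrite sw mulrAC.
have [del del0 hdel] := finite_separation
  (flatten [seq [:: (ends w).1; (ends w).2] | w : n.-tuple 'I_4]) d1m.
have mem w a : size w = n -> corner w a -> a \in
    flatten [seq [:: (ends w).1; (ends w).2] | w : n.-tuple 'I_4].
  move=> /eqP sw wa; apply/flatten_mapP; exists (Tuple sw).
    exact: mem_enum.
  by rewrite !inE; case: wa => -> /=; rewrite eqxx ?orbT.
exists del => // x y xy.
have [w1 sw1 wx] := cell_cover n x; have [w2 sw2 wy] := cell_cover n y.
have [[c c1 c2]|nc] := pselect (exists2 c, corner w1 c & corner w2 c).
  have hx := hcell _ _ sw1 wx; have hy := hcell _ _ sw2 wy.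
  have hc1 := hcell _ _ sw1 (or_introl c1); have hc2 := hcell _ _ sw2 (or_introl c2).
  have := t2 c x y; have := t2 (ends w1).1 x c; have := t2 (ends w2).1 c y.
  by rewrite (s2 (ends w1).1 c) (s2 (ends w2).1 y); lra.
exfalso; have w12 : w1 <> w2.
  by move=> w12; apply: nc; exists (ends w1).1; [left|rewrite w12; left].
have yw1 : ~ inner w1 y.
  case: wy => [cy|[u ->] [u' [uw]]].
    by apply: corner_not_inner cy; rewrite sw1.
  have su : size u = size u'.
    by have := congr1 size uw; rewrite !size_cat sw1 sw2 => /addIn.
  by move: uw => /eqP; rewrite eqseq_cat// => /andP[_ /eqP/esym].
have [a wa ha] := sep w1 x y wx yw1.
have [|b wb hb] := sep w2 y a wy; first by apply: corner_not_inner wa; rewrite sw1.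
have ab : a != b by apply/eqP => ab; apply: nc; exists a => //; rewrite ab.
have := hdel a b (mem _ _ sw1 wa) (mem _ _ sw2 wb) ab.
have := g1 x a; have := g1 y b; rewrite (s1 a b); rewrite (s1 y a) in hb; lra.
Qed.

End separation.

(** * Completions of metrics on the vertices *)

Lemma mdist_via (R : realFieldType) (T : metricType R) (y x z : T) :
  mdist x z <= mdist x y + mdist y z.
Proof. exact: metric_triangle. Qed.

Section extension.
Context (R : realType).
Implicit Types d : metrics R.

Definition unif_finer d1 d2 : Prop := forall e : R, 0 < e ->
  exists2 del : R, 0 < del &
    forall x y, mval d1 (x, y) < del -> mval d2 (x, y) <= e.

(** The graph of the extension of the identity of [V_infty] to the two
    completions. As a relation it is symmetric in the two metrics, so that the
    extension and its inverse are treated at once. *)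
Definition same_limit d1 d2 (p : completion d1) (q : completion d2) : Prop :=
  forall e : R, 0 < e ->
    exists2 v, mdist p (inclV d1 v) <= e & mdist q (inclV d2 v) <= e.

Lemma same_limit_sym d1 d2 (p : completion d1) (q : completion d2) :
  same_limit p q -> same_limit q p.
Proof. by move=> h e /h[v hp hq]; exists v. Qed.

Lemma same_limit_incl d1 d2 v : same_limit (inclV d1 v) (inclV d2 v).
Proof. by move=> e e0; exists v; rewrite mdistxx ltW. Qed.

Lemma same_limit_unif d1 d2 : unif_finer d1 d2 ->
  forall e : R, 0 < e -> exists2 del : R, 0 < del &
    forall (p p' : completion d1) (q q' : completion d2),
      same_limit p q -> same_limit p' q' ->
      mdist p p' < del -> mdist q q' <= e.
Proof.
move=> h12 e e0; have e30 : 0 < e / 3 by lra.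
have [del del0 hdel] := h12 _ e30.
exists (del / 3) => [|p p' q q' pq pq' pp']; first by lra.
have m0 : 0 < Num.min (del / 4) (e / 3) by rewrite lt_min; lra.
have [v] := pq _ m0; rewrite !le_min => /andP[pv _] /andP[_ qv].
have [v'] := pq' _ m0; rewrite !le_min => /andP[pv' _] /andP[_ qv'].
have : mval d2 (v, v') <= e / 3.
  apply: hdel; rewrite -(inclV_isometry d1).
  have := mdist_via p (inclV d1 v) (inclV d1 v').
  have := mdist_via p' p (inclV d1 v').
  rewrite (metric_sym (inclV d1 v) p); lra.
rewrite -(inclV_isometry d2).
have := mdist_via (inclV d2 v) q q'.
have := mdist_via (inclV d2 v') (inclV d2 v) q'.
rewrite (metric_sym (inclV d2 v') q'); lra.
Qed.

(** The points of [V_infty] that are close to [p] form a Cauchy filter for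
    the second metric. *)
Lemma same_limit_ex d1 d2 (p : completion d1) : unif_finer d1 d2 ->
  exists q : completion d2, same_limit p q.
Proof.
move=> h12.
pose B (e : R) := [set q | exists2 v, mdist p (inclV d1 v) <= e & q = inclV d2 v].
pose F := filter_from [set e : R | 0 < e] B.
have FF : ProperFilter F.
  apply: filter_from_proper; last first.
    by move=> e /(inclV_dense p)[v hv]; exists (inclV d2 v), v.
  apply: filter_from_filter; first by exists 1; exact: ltr01.
  move=> e e' /= e0 e'0; exists (Num.min e e'); first by rewrite lt_min e0.
  by move=> z [v + ->]; rewrite le_min => /andP[h1 h2]; split; exists v.
have : cauchy F.
  apply/cauchyP => e e0; have e20 : 0 < e / 2 by lra.
  have [del del0 hdel] := h12 _ e20; have del30 : 0 < del / 3 by lra.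
  have [v hv] := inclV_dense p del30.
  exists (inclV d2 v); exists (del / 3) => // z [v' hv' ->].
  rewrite ballEmdist /= inclV_isometry.
  have : mval d2 (v, v') <= e / 2; last by lra.
  apply: hdel; rewrite -(inclV_isometry d1).
  have := mdist_via p (inclV d1 v) (inclV d1 v').
  by rewrite (metric_sym (inclV d1 v) p); lra.
move=> /(completion_complete FF)/cvg_ex[q qF]; exists q => e e0.
have : F [set x | B e x].
  by exists e.
have : F (ball q e) by apply: qF; apply: nbhsx_ballx.
move=> h1 h2; have [x []] := filter_ex (filterI h1 h2).
rewrite ballEmdist /= => qx [v pv xE]; exists v => //.
by rewrite -xE ltW.
Qed.

Lemma same_limit_uniq d1 d2 (p : completion d1) (q q' : completion d2) :
  unif_finer d1 d2 -> same_limit p q -> same_limit p q' -> q = q'.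
Proof.
move=> h12 pq pq'; apply: mdist_positivity; apply/eqP.
rewrite eq_le mdist_ge0 andbT; apply/ler_addgt0Pr => e e0; rewrite add0r.
have [del del0] := same_limit_unif h12 e0.
by move=> /(_ p p q q' pq pq'); apply; rewrite mdistxx.
Qed.

Lemma unif_equiv_homeomorphism d1 d2 : unif_finer d1 d2 -> unif_finer d2 d1 ->
  exists2 f : completion d1 -> completion d2,
    homeomorphism f & forall v, f (inclV d1 v) = inclV d2 v.
Proof.
move=> h12 h21.
have [f hf] := choice (fun p => same_limit_ex p h12).
have [g hg] := choice (fun q => same_limit_ex q h21).
have cont (e1 e2 : metrics R) (h : completion e1 -> completion e2) :
    unif_finer e1 e2 -> (forall p, same_limit p (h p)) -> continuous h.
  move=> u hh p; have Fp : Filter (nbhs p) by exact: nbhs_filter.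
  apply/cvg_ballP => e e0; have e20 : 0 < e / 2 by lra.
  have [del del0 hdel] := same_limit_unif u e20.
  apply: filterS (nbhsx_ballx p del del0) => p'; rewrite !ballEmdist /= => pp'.
  by have := hdel p p' _ _ (hh p) (hh p') pp'; lra.
exists f; last first.
  by move=> v; apply: same_limit_uniq h12 (hf _) _; exact: same_limit_incl.
exists g; split; [exact: cont hf|exact: cont hg| |].
- move=> p; apply: same_limit_uniq h21 (hg _) _; exact: same_limit_sym.
- move=> q; apply: same_limit_uniq h12 (hf _) _; exact: same_limit_sym.
Qed.

Lemma decay_homeomorphism d C r : (forall w, separates (mval d) w) ->
  0 <= r -> r < 1 -> 0 <= C -> decay (mval d) C r ->
  exists2 f : Gamma_infty R -> completion d,
    homeomorphism f & forall v, f (inclV (std_metric R) v) = inclV d v.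
Proof.
move=> sep r0 r1 C0 hd; apply: unif_equiv_homeomorphism.
- move=> e e0; apply: separates_unif_continuous r0 r1 C0 hd _ e0.
  + exact: std_dist_metric.
  + exact: mvalP.
  + exact: separates_std.
- move=> e e0; apply: (separates_unif_continuous _ _ _ _ _ _ (decay_std R)) => //.
  + exact: mvalP.
  + exact: std_dist_metric.
  + by rewrite invf_lt1// ltr1n.
Qed.

End extension.

Section dimension.
Context (R : realType) (d : metrics R).
Local Open Scope ereal_scope.

(** The [4 ^ n] balls of radius of order [r ^ n] centred at the initial
    endpoints of the edges of generation [n] cover the space, and the sum of the
    [h]-th powers of their diameters is of order [(4 * r `^ h) ^+ n]. *)
Lemma hausdorff_measure_decay0 (C r h : R) : (0 < r < 1)%R -> (0 <= C)%R ->
  decay (mval d) C r -> (0 < h)%R -> (4 * r `^ h < 1)%R ->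
  hausdorff_measure h [set: completion d] = 0.
Proof.
move=> /andP[r00 r1] C0 hd h0 hr; have r0 := ltW r00.
(* [K / 2 * r ^+ n] is the radius of a cell of generation [n] enlarged by
   [r ^+ n], within which every point of the completion has a point of
   [V_infty]. *)
pose K := ((2 * (C / (1 - r) + 1)))%R.
have K0 : (0 <= K)%R by rewrite mulr_ge0// addr_ge0// divr_ge0// subr_ge0 ltW.
have diam_ge0 (A : set (completion d)) : 0 <= diam A.
  by apply: ereal_sup_ubound; left.
have prem_ge0 delta : 0 <= hausdorff_premeasure h delta [set: completion d].
  apply: le_ereal_inf_tmp => _ [U _ <-]; apply: nneseries_ge0 => i _ _.
  exact: poweR_ge0.
apply/eqP; rewrite eq_le; apply/andP; split; last first.
  apply: le_trans (prem_ge0 1%R) _; apply: ereal_sup_ubound; exists 1%R => //.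
  by rewrite /= ltr01.
apply: ge_ereal_sup => _ [delta /= delta0 <-].
suff bound n : (K * r ^+ n <= delta)%R ->
    hausdorff_premeasure h delta [set: completion d] <=
    (K `^ h * (4 * r `^ h) ^+ n)%:E.
  apply/lee_addgt0Pr => e e0; rewrite add0e.
  have [N1 hN1] := cvg_geo_small K r0 r1 delta0.
  have [|N2 hN2] := cvg_geo_small (K `^ h) _ hr e0.
    by rewrite mulr_ge0// powR_ge0.
  have lem (c x : R) a b : (0 <= c)%R -> (0 <= x <= 1)%R -> (a <= b)%N ->
      (c * x ^+ b <= c * x ^+ a)%R.
    move=> c0 /andP[x0 x1] ab; apply: ler_wpM2l => //; exact: ler_wiXn2l.
  apply: le_trans (bound (maxn N1 N2) _) _.
    by apply: le_trans hN1; apply: lem => //; [rewrite r0 ltW|exact: leq_maxl].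
  rewrite lee_fin; apply: le_trans hN2; apply: lem; rewrite ?powR_ge0//.
    by rewrite mulr_ge0 ?powR_ge0// ltW.
  exact: leq_maxr.
move=> hn.
pose ws : seq (n.-tuple 'I_4) := enum {: n.-tuple 'I_4}.
have sws : size ws = (4 ^ n)%N by rewrite -cardE card_tuple card_ord.
pose U i : set (completion d) := if (i < 4 ^ n)%N then
  [set p | (mdist p (inclV d (ends (nth [tuple of nseq n ord0] ws i)).1)
            <= K / 2 * r ^+ n)%R] else set0.
have dU i : diam (U i) <= (if (i < 4 ^ n)%N then K * r ^+ n else 0)%R%:E.
  apply: ge_ereal_sup => _ [->|[[p q] /= [Up Uq] <-]].
    by case: ifP => _; rewrite lee_fin// mulr_ge0// exprn_ge0.
  move: Up Uq; rewrite /U; case: ifP => // _ /= hp hq.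
  rewrite lee_fin.
  have := mdist_via (inclV d (ends (nth [tuple of nseq n ord0] ws i)).1) p q.
  by rewrite (metric_sym q) in hq; lra.
apply: (@le_trans _ _ (\sum_(0 <= i <oo) diam (U i) `^ h)).
  apply: ereal_inf_lbound; exists U => //; split; last first.
    move=> i; apply: (le_trans (dU i)); rewrite lee_fin; case: ifP => // _.
    exact: ltW.
  move=> p _; have rn0 : (0 < r ^+ n)%R by exact: exprn_gt0.
  have [v hv] := inclV_dense p rn0.
  have [w sw wv] := cell_cover n v; move/eqP: sw => sw.
  have hcell := decay_cell (mvalP d) r0 r1 C0 hd wv.
  exists (index (Tuple sw) ws) => //; rewrite /U -sws index_mem mem_enum /=.
  rewrite nth_index ?mem_enum//=.
  have := mdist_via (inclV d v) p (inclV d (ends w).1).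
  rewrite inclV_isometry; move: hcell; rewrite (eqP sw) mulrAC /K.
  set c := (C / (1 - r))%R; have -> : (2 * (c + 1) / 2 = c + 1)%R by lra.
  by rewrite mulrDl mul1r; lra.
rewrite (nneseries_split 0 (4 ^ n)); last by move=> k _; exact: poweR_ge0.
rewrite add0n [X in _ + X]eseries0 ?adde0; last first.
  move=> i; rewrite leqNgt => /negPf hi _; have := dU i; rewrite hi => hi0.
  have -> : diam (U i) = 0 by apply/eqP; rewrite eq_le hi0 diam_ge0.
  by rewrite poweR0r// gt_eqF.
apply: (@le_trans _ _ (\sum_(0 <= i < 4 ^ n) ((K * r ^+ n) `^ h)%:E)).
  rewrite !big_nat; apply: lee_sum => i /andP[_ hi].
  rewrite -poweR_EFin; apply: gt0_ler_poweR; rewrite ?in_itv/= ?leey ?diam_ge0//.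
  - exact: ltW.
  - by rewrite lee_fin mulr_ge0// exprn_ge0.
  - by have := dU i; rewrite hi.
rewrite sumEFin lee_fin sumr_const_nat subn0 powRM ?exprn_ge0// exprMn.
rewrite -[leLHS]mulr_natl natrX -(powR_mulrn n r0) -powRrM (mulrC n%:R).
by rewrite powRrM powR_mulrn ?powR_ge0// mulrCA.
Qed.

End dimension.

(** * Measurability and product laws *)

Section countable_operations.
Context d (T : measurableType d).

Lemma measurable_bigcup_countType (I : countType) (F : I -> set T) :
  (forall i, measurable (F i)) -> measurable (\bigcup_i F i).
Proof.
move=> mF.
have -> : \bigcup_i F i = \bigcup_n oapp F set0 (unpickle n).
  apply/seteqP; split=> t [i _].
    by move=> Fit; exists (pickle i) => //; rewrite pickleK.
  by case: unpickle => [j|//] Fjt; exists j.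
by apply: bigcupT_measurable => n; case: unpickle => [i|] /=; [exact: mF|].
Qed.

Lemma measurable_bigcap_countType (I : countType) (F : I -> set T) :
  (forall i, measurable (F i)) -> measurable (\bigcap_i F i).
Proof.
move=> mF; rewrite -(setCK (\bigcap_i F i)) setC_bigcap.
by apply/measurableC/measurable_bigcup_countType => i; exact/measurableC.
Qed.

End countable_operations.

Section evaluations.
Context (R : realType).

(** All the events considered below are countable combinations of
    evaluations, so this is the form in which measurability of [Rlambda] is used. *)
Definition eval_measurable d (T : measurableType d) (f : T -> metrics R) : Prop :=
  forall xy, measurable_fun setT (fun t => mval (f t) xy).

Lemma continuous_mval xy : continuous (fun e : metrics R => mval e xy).
Proof.
move=> e.
apply: (@continuous_comp _ _ _ (fun e : metrics R => val e : {ptws Vinf * Vinf -> R})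
  (fun g : {ptws Vinf * Vinf -> R} => g xy)).
  exact: initial_continuous.
exact: (@proj_continuous (Vinf * Vinf)%type (fun=> R) xy).
Qed.

Lemma eval_measurable_id : eval_measurable (@id (metrics R)).
Proof.
move=> xy.
apply: (@measurability _ _ (metrics R) (measurableTypeR R) setT _
  _ (RGenOpens.measurableE R)) => _ [_ [a [b ->]] <-].
rewrite setTI; apply: sub_sigma_algebra.
by apply: open_comp; [move=> x _; exact: continuous_mval|exact: interval_open].
Qed.

Lemma eval_measurable_comp d (T : measurableType d) (f : T -> metrics R) :
  measurable_fun setT f -> eval_measurable f.
Proof. by move=> mf xy; exact: measurableT_comp (eval_measurable_id xy) mf. Qed.

Definition Rlambda_dom : Type := (metrics R * metrics R * metrics R * metrics R * posreals R)%type.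

Lemma measurable_quad i : measurable_fun setT
  (fun p : metrics R * metrics R * metrics R * metrics R => quad p i).
Proof.
have m2 := measurableT_comp (@measurable_fst _ _ (metrics R * metrics R)%type (metrics R))
 (@measurable_fst _ _ (metrics R * metrics R * metrics R)%type (metrics R)).
case: i => [[|[|[|[|//]]]]] ? /=.
- exact: measurableT_comp measurable_fst m2.
- exact: measurableT_comp measurable_snd m2.
- exact: measurableT_comp measurable_snd measurable_fst.
- exact: measurable_snd.
Qed.

(** The glued distance is an infimum over chains, which are countably many. *)
Lemma measurable_glue d (T : measurableType d) (f : 'I_4 -> T -> metrics R) xy :
  (forall i, eval_measurable (f i)) ->
  measurable_fun setT (fun t => Defs.glue (fun i => f i t) xy).
Proof.
move=> mf mT; apply: (measurability _ (RGenInftyO.measurableE R)) => // _ [_ [r ->] <-].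
rewrite setTI.
have -> : (fun t => Defs.glue (fun i => f i t) xy) @^-1` `]-oo, r[ =
    \bigcup_(s : seq ('I_4 * Vinf * Vinf)) ((fun t => if `[< chain xy.1 s xy.2 >]
       then cost (fun i => f i t) s else r) @^-1` `]-oo, r[).
  apply/seteqP; split=> t /=; rewrite in_itv /=.
    move=> /(inf_lt _)[|_ [s hs <-] hr].
      by have [s hs] := chain_ex (f^~ t) xy.1 xy.2; exists (cost (f^~ t) s), s.
    by exists s => //=; rewrite in_itv /=; case: asboolP.
  move=> [s _ /=]; rewrite in_itv /=; case: asboolP; last by rewrite ltxx.
  by case: xy => x y /= hs; apply: le_lt_trans; exact: glue_le.
apply: measurable_bigcup_countType => s; rewrite -[X in measurable X]setTI.
suff : measurable_fun setT (fun t => if `[< chain xy.1 s xy.2 >]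
    then cost (fun i => f i t) s else r) by apply => //; exact: measurable_itv.
case: asboolP => _; last exact: measurable_cst.
by apply: measurable_sum => -[[i a] b]; exact: mf.
Qed.

Lemma eval_measurable_Rlambda (l : posreals R) :
  eval_measurable (fun p : Rlambda_dom => Rlambda l p).
Proof.
move=> xy; apply: measurable_funM.
  apply: measurable_funM => //.
  exact: measurableT_comp (@measurable_rval R) measurable_snd.
apply: measurable_glue => i; apply: eval_measurable_comp.
exact: measurableT_comp (measurable_quad i) measurable_fst.
Qed.

End evaluations.

Section product_integrals.
Local Open Scope ereal_scope.
Context d1 d2 (T1 : measurableType d1) (T2 : measurableType d2) (R : realType).
Variables (P1 : probability T1 R) (P2 : probability T2 R).

Lemma integral_prodM (f : T1 -> \bar R) (g : T2 -> \bar R) :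
  measurable_fun setT f -> measurable_fun setT g ->
  (forall x, 0 <= f x) -> (forall y, 0 <= g y) ->
  \int[P1 \x P2]_z (f z.1 * g z.2) = \int[P1]_x f x * \int[P2]_y g y.
Proof.
move=> mf mg f0 g0.
rewrite (@fubini_tonelli1 _ _ _ _ _ P1 P2 (fun z => f z.1 * g z.2))//; last 2 first.
- apply: emeasurable_funM; first exact: measurableT_comp mf measurable_fst.
  exact: measurableT_comp mg measurable_snd.
- by move=> z; rewrite mule_ge0.
rewrite -ge0_integralZr//; last by rewrite integral_ge0.
by apply: eq_integral => x _; rewrite /fubini_F /= ge0_integralZl.
Qed.

Lemma integral_prod_fst (f : T1 -> \bar R) :
  measurable_fun setT f -> (forall x, 0 <= f x) ->
  \int[P1 \x P2]_z f z.1 = \int[P1]_x f x.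
Proof.
move=> mf f0; transitivity (\int[P1 \x P2]_z (f z.1 * cst 1 z.2)).
  by apply: eq_integral => z _; rewrite /= mule1.
rewrite integral_prodM// integral_cst// mul1e.
by rewrite [X in _ * X](_ : _ = 1) ?mule1//; exact: probability_setT.
Qed.

Lemma integral_prod_snd (g : T2 -> \bar R) :
  measurable_fun setT g -> (forall y, 0 <= g y) ->
  \int[P1 \x P2]_z g z.2 = \int[P2]_y g y.
Proof.
move=> mg g0; transitivity (\int[P1 \x P2]_z (cst 1 z.1 * g z.2)).
  by apply: eq_integral => z _; rewrite /= mul1e.
rewrite integral_prodM// integral_cst// mul1e.
by rewrite [X in X * _](_ : _ = 1) ?mul1e//; exact: probability_setT.
Qed.

Lemma integral_prod_iter (f : T1 * T2 -> \bar R) :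
  measurable_fun setT f -> (forall z, 0 <= f z) ->
  \int[P1 \x P2]_z f z = \int[P2]_y \int[P1]_x f (x, y).
Proof. by move=> mf f0; exact: (@fubini_tonelli2 _ _ _ _ _ P1 P2 f). Qed.

Lemma measurable_integral_fst (f : T1 * T2 -> \bar R) :
  measurable_fun setT f -> (forall z, 0 <= f z) ->
  measurable_fun setT (fun y => \int[P1]_x f (x, y)).
Proof.
by move=> mf f0; exact: (@measurable_fun_fubini_tonelli_G _ _ _ _ _ P1 f).
Qed.

End product_integrals.

(** * Stationary laws *)

Section stationarity.
Context (R : realType) (l : posreals R) (m : probability (posreals R) R)
  (mb : probability (metrics R) R).
Hypothesis mb_stationary : forall A, measurable A -> Phi l m mb A = mb A.
Local Open Scope ereal_scope.

Local Notation mb4 := (((mb \x mb) \x mb) \x mb).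
Local Notation law := (mb4 \x m).
Local Notation quad4 := (metrics R * metrics R * metrics R * metrics R)%type.

Lemma stationary_set A : measurable A -> mb A = law ((fun p => Rlambda l p) @^-1` A).
Proof. by move=> mA; rewrite -[LHS]mb_stationary. Qed.

(** It suffices to compare the laws of [F] under both measures on the extended
    real line. *)
Lemma stationary_integral (F : metrics R -> \bar R) :
  measurable_fun setT F -> measurable_fun setT (fun p : Rlambda_dom R => F (Rlambda l p)) ->
  (forall d, 0 <= F d) ->
  \int[mb]_d F d = \int[law]_p F (Rlambda l p).
Proof.
move=> mF mFR F0.
pose X : {mfun metrics R >-> \bar R} :=
  HB.pack F (isMeasurableFun.Build _ _ _ _ _ mF).
pose Y : {mfun Rlambda_dom R >-> \bar R} :=
  HB.pack (fun p : Rlambda_dom R => F (Rlambda l p)) (isMeasurableFun.Build _ _ _ _ _ mFR).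
transitivity (\int[distribution mb X]_y `|y|).
  by rewrite ge0_integral_distribution//; apply: eq_integral => d _; rewrite /= gee0_abs.
transitivity (\int[distribution law Y]_y `|y|).
  apply: eq_measure_integral => A mA _.
  apply: stationary_set; rewrite -[X in measurable X]setTI.
  exact: (mF measurableT A mA).
by rewrite ge0_integral_distribution//; apply: eq_integral => d _; rewrite /= gee0_abs.
Qed.

Lemma integral_quad i (f : metrics R -> \bar R) :
  measurable_fun setT f -> (forall d, 0 <= f d) ->
  \int[mb4]_p f (quad p i) = \int[mb]_d f d.
Proof.
move=> mf f0.
have mfst := measurableT_comp mf.
case: i => [[|[|[|[|//]]]]] ?.
- rewrite (@integral_prod_fst _ _ _ _ _ ((mb \x mb) \x mb) mb (fun p => f p.1.1)) //; last first.
    by apply: mfst; exact: measurableT_comp measurable_fst measurable_fst.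
  rewrite (@integral_prod_fst _ _ _ _ _ (mb \x mb) mb (fun p => f p.1)) //; last first.
    by apply: mfst; exact: measurable_fst.
  by rewrite (@integral_prod_fst _ _ _ _ _ mb mb f).
- rewrite (@integral_prod_fst _ _ _ _ _ ((mb \x mb) \x mb) mb (fun p => f p.1.2)) //; last first.
    by apply: mfst; exact: measurableT_comp measurable_snd measurable_fst.
  rewrite (@integral_prod_fst _ _ _ _ _ (mb \x mb) mb (fun p => f p.2)) //; last first.
    by apply: mfst; exact: measurable_snd.
  by rewrite (@integral_prod_snd _ _ _ _ _ mb mb f).
- rewrite (@integral_prod_fst _ _ _ _ _ ((mb \x mb) \x mb) mb (fun p => f p.2)) //; last first.
    by apply: mfst; exact: measurable_snd.
  by rewrite (@integral_prod_snd _ _ _ _ _ (mb \x mb) mb f).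
- by rewrite (@integral_prod_snd _ _ _ _ _ ((mb \x mb) \x mb) mb f).
Qed.

Lemma law_quad i A : measurable A -> law [set p | A (quad p.1 i)] = mb A.
Proof.
move=> mA; pose f := EFin \o \1_A : metrics R -> \bar R.
have mf : measurable_fun setT f by exact/measurable_EFinP.
have mfq : measurable_fun setT (fun p : quad4 => f (quad p i)).
  exact: measurableT_comp mf (measurable_quad i).
have f0 d : 0 <= f d by rewrite /f /= lee_fin.
transitivity (\int[law]_p f (quad p.1 i)); last first.
  rewrite (@integral_prod_fst _ _ _ _ _ mb4 m (fun p => f (quad p i)))//.
  by rewrite integral_quad// integral_indic// setIT.
rewrite (_ : (fun p => f (quad p.1 i)) = EFin \o \1_[set p : Rlambda_dom R | A (quad p.1 i)]).
  rewrite integral_indic ?setIT//.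
  rewrite -[X in measurable X]setTI.
  apply: (measurableT_comp (measurable_quad i) measurable_fst) => //.
by apply/funext => p /=; rewrite /f /= !indicE; congr (_%:E); congr (_ %:R); congr nat_of_bool;
  apply/idP/idP; rewrite !inE.
Qed.

End stationarity.

Section separation_ae.
Context (R : realType).

Lemma measurable_separates d (T : measurableType d) (f : T -> metrics R) w :
  eval_measurable f -> measurable [set t | separates (mval (f t)) w].
Proof.
move=> mf.
pose ok (a x y : Vinf) := [set t | mval (f t) (x, a) + mval (f t) (a, y) <= mval (f t) (x, y)].
have mok a x y : measurable (ok a x y).
  rewrite -[X in measurable X]setTI.
  have := measurable_fun_ler (measurable_funD (mf (x, a)) (mf (a, y))) (mf (x, y)).
  by move=> /(_ measurableT [set true]) ; apply.
rewrite (_ : [set t | _] = \bigcap_(x : Vinf) \bigcap_(y : Vinf)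
    (if pselect (cell w x /\ ~ inner w y) then ok (ends w).1 x y `|` ok (ends w).2 x y
     else setT)).
  do 2 apply: measurable_bigcap_countType => ?.
  case: pselect => h //=; exact: measurableU.
apply/seteqP; split=> t /= ht.
  move=> x _ y _; case: pselect => [[h1 h2]|//].
  by have [a wa ha] := ht x y h1 h2; case: wa ha => -> ha; [left|right].
move=> x y h1 h2; have := ht x I y I; case: pselect => [hh|[]//].
by case=> h; [exists (ends w).1; [left|]|exists (ends w).2; [right|]].
Qed.

Variables (l : posreals R) (m : probability (posreals R) R)
  (mb : probability (metrics R) R).
Hypothesis mb_stationary : forall A, measurable A -> Phi l m mb A = mb A.

(** Separation by [w] in the [i]-th copy gives separation by [rcons w i] in
    the glued space, whose law is the same: induction on the length of the word. *)
Lemma stationary_separates : {ae mb, forall d, forall w, separates (mval d) w}.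
Proof.
suff h w : mb (~` [set d | separates (mval d) w]) = 0%E.
  have {}h w : {ae mb, forall d, separates (mval d) w}.
    exists (~` [set d : metrics R | separates (mval d) w]); split => //.
    apply: measurableC; apply: measurable_separates; exact: eval_measurable_id.
  have : {ae mb, forall d, forall n, separates (mval d) (odflt [::] (unpickle n))}.
    by apply: ae_foralln => n; exact: h.
  by apply: filterS => d hd w; have := hd (pickle w); rewrite pickleK.
elim/last_ind: w => [|w i IH].
  rewrite (_ : [set d | _] = setT) ?setCT ?measure0//.
  by apply/seteqP; split => // d _; apply: separates_nil; exact: mvalP.
have mS w' : measurable [set d : metrics R | separates (mval d) w'].
  by apply: measurable_separates; exact: eval_measurable_id.
rewrite (stationary_set mb_stationary); last exact: measurableC.
apply/eqP; rewrite eq_le measure_ge0 andbT -IH -(law_quad m mb i); last exact: measurableC.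
apply: le_measure; rewrite ?inE.
- apply: measurableC; apply: measurable_separates; exact: eval_measurable_Rlambda.
- apply: measurableC; apply: measurable_separates; apply: eval_measurable_comp.
  exact: measurableT_comp (measurable_quad i) measurable_fst.
- move=> p /=; apply: contra_not => h; apply: separates_scale; last exact: separates_glue.
  by rewrite mulr_gt0// rval_gt0.
Qed.

End separation_ae.

(** * Moments of the distance between the endpoints *)

Section tightness.
Context d (T : measurableType d) (R : realType) (P : probability T R).
Local Open Scope ereal_scope.

Lemma measurable_superlevel (f : T -> R) (K : R) : measurable_fun setT f ->
  measurable [set t | K < f t]%R.
Proof.
move=> mf; have -> : [set t | K < f t]%R = setT `&` f @^-1` `]K, +oo[%classic.
  by rewrite setTI; apply/seteqP; split=> t /=; rewrite in_itv /= andbT.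
by apply: mf => //; exact: measurable_itv.
Qed.

Lemma probability_tight (f : T -> R) (eps : R) : measurable_fun setT f ->
  (0 < eps)%R -> exists2 K : R, (0 < K)%R & P [set t | K < f t]%R <= eps%:E.
Proof.
move=> mf eps0; pose F (n : nat) : set T := [set t | n.+1%:R < f t]%R.
have mF n : measurable (F n) by exact: measurable_superlevel.
have PF : P \o F @ \oo --> P (\bigcap_n F n).
  apply: nonincreasing_cvg_mu => //.
  - by rewrite ltey_eq fin_num_measure.
  - exact: bigcapT_measurable.
  - move=> n k nk; apply/subsetPset => t; rewrite /F /=; apply: le_lt_trans.
    by rewrite ler_nat.
have F0 : \bigcap_n F n = set0.
  apply/seteqP; split => // t /(_ (Num.bound `|f t|%R) I); rewrite /F /= ltNge.
  apply/negP/negPn; apply: le_trans (ler_norm _) _.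
  by apply: le_trans (ltW (archi_boundP (normr_ge0 _))) _; rewrite ler_nat.
rewrite F0 measure0 in PF; apply: contrapT => hno.
have : eps%:E <= limn (P \o F).
  apply: lime_ge; first by apply/cvg_ex; eexists; exact: PF.
  exists 0%N => // n /= _; rewrite leNgt; apply/negP => h; apply: hno.
  by exists n.+1%:R; [rewrite ltr0n|exact: ltW].
by rewrite (cvg_lim _ PF)// lee_fin leNgt eps0.
Qed.

End tightness.

Section endpoint_distance.
Context (R : realType).

Definition dist_IO (d : metrics R) : R := mval d (vI, vO).

Lemma Rlambda_le_step (l : posreals R) (p : Rlambda_dom R) i a b :
  mval (Rlambda l p) (copy i a, copy i b) <=
  rval l * rval p.2 * mval (quad p.1 i) (a, b).
Proof.
rewrite /Rlambda /mval /= ler_pM2l ?mulr_gt0 ?rval_gt0//.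
have /(glue_le (quad p.1)) : chain (copy i a) [:: (i, a, b)] (copy i b) by [].
by rewrite /cost big_seq1.
Qed.

(** One may go through either of [e_1], [e_2] and then either of [e_3], [e_4]. *)
Lemma dist_IO_Rlambda (l : posreals R) (p : Rlambda_dom R) :
  dist_IO (Rlambda l p) <= rval l * rval p.2 *
    (Num.min (dist_IO p.1.1.1.1) (dist_IO p.1.1.1.2) +
     Num.min (dist_IO p.1.1.2) (dist_IO p.1.2)).
Proof.
rewrite /dist_IO {1}/Rlambda {1}/mval /= ler_pM2l ?mulr_gt0 ?rval_gt0//.
have route (i j : 'I_4) : (i < 2)%N -> (2 <= j)%N ->
    Defs.glue (quad p.1) (vI, vO) <=
    mval (quad p.1 i) (vI, vO) + mval (quad p.1 j) (vI, vO).
  move=> i2 j2; have /(glue_le (quad p.1)) : chain vI [:: (i, vI, vO); (j, vI, vO)] vO.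
    by rewrite /= i2 ltnNge j2.
  by rewrite /cost big_cons big_seq1.
have i0 : (0 < 4)%N by []. have i1 : (1 < 4)%N by [].
have i2 : (2 < 4)%N by []. have i3 : (3 < 4)%N by [].
have h02 := route (Ordinal i0) (Ordinal i2) isT isT.
have h03 := route (Ordinal i0) (Ordinal i3) isT isT.
have h12 := route (Ordinal i1) (Ordinal i2) isT isT.
have h13 := route (Ordinal i1) (Ordinal i3) isT isT.
have lem (x a b c e : R) : x <= a + c -> x <= a + e -> x <= b + c -> x <= b + e ->
    x <= Num.min a b + Num.min c e by case: (leP a b); case: (leP c e).
exact: lem h02 h03 h12 h13.
Qed.

Lemma dist_IO_ge0 d : 0 <= dist_IO d. Proof. exact: mval_ge0. Qed.

(** A factor [y >= 1] comes out of a truncation, [min (y * u) T <= y * min u T];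
    this is why [z] is replaced with [max 1 z]. *)
Lemma powR_truncated_sum (s z m1 m2 T : R) : 0 < s -> 0 <= z -> 0 <= m1 -> 0 <= m2 ->
  0 <= T ->
  Num.min (z * (m1 + m2)) T `^ s <=
  (2 * Num.max 1 z) `^ s * (Num.min m1 T `^ s + Num.min m2 T `^ s).
Proof.
move=> s0 z0 m10 m20 T0; set y := Num.max 1 z.
have y1 : 1 <= y by rewrite le_max lexx.
have zy : z <= y by rewrite le_max lexx orbT.
wlog m12 : m1 m2 m10 m20 / m1 <= m2.
  move=> h; have [/h|/ltW/h] := leP m1 m2; first exact.
  by rewrite addrC [X in _ <= _ * X]addrC; exact.
have mT0 : 0 <= Num.min m2 T by rewrite le_min m20.
apply: (@le_trans _ _ ((2 * y * Num.min m2 T) `^ s)).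
  apply: ge0_ler_powR; rewrite ?nnegrE; first exact: ltW.
  - by rewrite le_min T0 mulr_ge0// addr_ge0.
  - by rewrite !mulr_ge0//; lra.
  - rewrite minr_pMr; last lra.
    rewrite le_min !ge_min; apply/andP; split; apply/orP; [left|right].
      have : z * (m1 + m2) <= y * (m1 + m2) by rewrite ler_wpM2r// addr_ge0.
      have : y * m1 <= y * m2 by rewrite ler_wpM2l//; lra.
      by rewrite mulrDr; lra.
    by rewrite ler_peMl//; lra.
rewrite powRM//; last lra.
by rewrite ler_wpM2l ?powR_ge0// lerDr powR_ge0.
Qed.

(** Above the level [K] both variables have to be large. Under a product law
    the last term is a truncated moment multiplied by a small tail probability. *)
Lemma powR_truncated_min (s x1 x2 T K : R) : 0 < s -> 0 <= x1 -> 0 <= x2 ->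
  0 <= T -> 0 <= K ->
  Num.min (Num.min x1 x2) T `^ s <=
  K `^ s + Num.min x1 T `^ s * ((K < x2)%R)%:R.
Proof.
move=> s0 x10 x20 T0 K0; have [x2K|Kx2] := leP x2 K.
  rewrite mulr0 addr0; apply: ge0_ler_powR; rewrite ?nnegrE//; first exact: ltW.
    by rewrite !le_min x10 x20.
  by rewrite !ge_min x2K orbT.
rewrite mulr1; apply: le_trans (_ : _ <= Num.min x1 T `^ s) _.
  apply: ge0_ler_powR; rewrite ?nnegrE ?le_min ?x10 ?x20//; first exact: ltW.
  by rewrite !ge_min !lexx /= orbT.
by rewrite lerDr powR_ge0.
Qed.

End endpoint_distance.

Section moments.
Context (R : realType) (l : posreals R) (m : probability (posreals R) R)
  (mb : probability (metrics R) R).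
Hypothesis mb_stationary : forall A, measurable A -> Phi l m mb A = mb A.
Variable s : R.
Hypothesis s_gt0 : (0 < s)%R.
Local Open Scope ereal_scope.
Hypothesis xi_moment : \int[m]_z ((rval l * rval z) `^ s)%:E < +oo.

Local Notation mb4 := (((mb \x mb) \x mb) \x mb).
Local Notation law := (mb4 \x m).
Local Notation X := (@dist_IO R).

Let Xs T d : R := Num.min (X d) T `^ s.

Lemma measurable_truncated dT (U : measurableType dT) (f : U -> metrics R) T :
  eval_measurable f -> measurable_fun setT (fun t => (Xs T (f t))%:E).
Proof.
move=> mf; apply/measurable_EFinP.
apply: (measurableT_comp (@measurable_powR R s)).
by apply: measurable_minr => //; exact: mf.
Qed.

Let Xs_ge0 T d : 0 <= (Xs T d)%:E. Proof. by rewrite lee_fin powR_ge0. Qed.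

Let J K d : \bar R := (((K < X d)%R)%:R : R)%:E.

Let mJ K : measurable_fun setT (J K).
Proof.
have -> : J K = EFin \o \1_[set d | (K < X d)%R].
  apply/funext => d; rewrite /J /= indicE; congr (_%:R%:E); congr nat_of_bool.
  by apply/idP/idP; rewrite inE.
apply/measurable_EFinP/measurable_indic.
by apply: measurable_superlevel; exact: eval_measurable_id.
Qed.

Let J_ge0 K d : 0 <= J K d. Proof. by rewrite lee_fin. Qed.

Lemma integral_truncated_pair (T K : R) :
  \int[mb4]_p ((Xs T p.1.1.1)%:E * J K p.1.1.2 + (Xs T p.1.2)%:E * J K p.2) =
  2 * (\int[mb]_d (Xs T d)%:E * \int[mb]_d J K d).
Proof.
have mX := measurable_truncated T (@eval_measurable_id R).
have m2 := measurableT_comp (@measurable_fst _ _ (metrics R * metrics R)%type (metrics R))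
 (@measurable_fst _ _ (metrics R * metrics R * metrics R)%type (metrics R)).
have mXJ : measurable_fun setT (fun p : metrics R * metrics R => (Xs T p.1)%:E * J K p.2).
  apply: emeasurable_funM; first exact: measurableT_comp mX measurable_fst.
  exact: measurableT_comp (mJ K) measurable_snd.
have mX2 : measurable_fun setT (fun p : metrics R * metrics R * metrics R => (Xs T p.2)%:E).
  exact: measurableT_comp mX measurable_snd.
rewrite ge0_integralD//; last 4 first.
- by move=> p _; rewrite mule_ge0.
- exact: (measurableT_comp mXJ m2).
- by move=> p _; rewrite mule_ge0.
- apply: emeasurable_funM; first exact: measurableT_comp mX2 measurable_fst.
  exact: measurableT_comp (mJ K) measurable_snd.
rewrite [RHS]mule_natl mule2n; congr (_ + _).
  rewrite (@integral_prod_fst _ _ _ _ _ ((mb \x mb) \x mb) mb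
    (fun p => (Xs T p.1.1)%:E * J K p.1.2)); last 2 first.
  - exact: (measurableT_comp mXJ measurable_fst).
  - by move=> p; rewrite mule_ge0.
  rewrite (@integral_prod_fst _ _ _ _ _ (mb \x mb) mb (fun p => (Xs T p.1)%:E * J K p.2))//; last first.
    by move=> p; rewrite mule_ge0.
  by rewrite (@integral_prodM _ _ _ _ _ mb mb (fun d => (Xs T d)%:E) (J K)).
rewrite (@integral_prodM _ _ _ _ _ ((mb \x mb) \x mb) mb (fun p => (Xs T p.2)%:E) (J K))//.
by rewrite (@integral_prod_snd _ _ _ _ _ (mb \x mb) mb (fun d => (Xs T d)%:E)).
Qed.


Lemma moment_max_finite : exists C : R,
  \int[m]_z ((2 * Num.max 1 (rval l * rval z)) `^ s)%:E = C%:E /\ (0 <= C)%R.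
Proof.
have mrv : measurable_fun setT (fun z : posreals R => (rval l * rval z)%R).
  by apply: measurable_funM => //; exact: measurable_rval.
have mpow (f : posreals R -> R) : measurable_fun setT f ->
    measurable_fun setT (fun z => (f z `^ s)%:E).
  by move=> mf; apply/measurable_EFinP; exact: measurableT_comp (@measurable_powR R s) mf.
have mz : measurable_fun setT (fun z : posreals R => ((2 * Num.max 1 (rval l * rval z)) `^ s)%:E).
  by apply: mpow; apply: measurable_funM => //; exact: measurable_maxr.
have z0 (x : R) : 0 <= (x `^ s)%:E by rewrite lee_fin powR_ge0.
have lz0 z : (0 <= rval l * rval z)%R by rewrite mulr_ge0// ltW// rval_gt0.
have fin : \int[m]_z ((2 * Num.max 1 (rval l * rval z)) `^ s)%:E < +oo.
  apply: (@le_lt_trans _ _ (\int[m]_z ((2 `^ s)%:E * (1 + ((rval l * rval z) `^ s)%:E)))).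
    apply: ge0_le_integral => //.
    - by apply: emeasurable_funM => //; apply: emeasurable_funD => //; exact: mpow.
    move=> z _; rewrite -EFinD -EFinM lee_fin (@powRM _ 2) ?le_max ?ler01//.
    rewrite ler_wpM2l ?powR_ge0//; have [h|h] := leP 1%R (rval l * rval z)%R.
      by rewrite lerDr.
    by rewrite powR1 lerDl powR_ge0.
  rewrite ge0_integralZl//; last 2 first.
  - by apply: emeasurable_funD => //; exact: mpow.
  - by move=> z _; rewrite adde_ge0.
  rewrite ge0_integralD//; last exact: mpow.
  rewrite integral_cst// mul1e; apply: lte_mul_pinfty => //.
  by apply: lte_add_pinfty => //; rewrite [X in X < _](_ : _ = 1) ?ltry//; exact: probability_setT.
exists (fine (\int[m]_z ((2 * Num.max 1 (rval l * rval z)) `^ s)%:E)).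
rewrite fine_ge0; last exact: integral_ge0.
by rewrite fineK// ge0_fin_numE//; exact: integral_ge0.
Qed.

(** With M(T) = E[min(X, T)^s] and C = E[(2 max(1, lambda xi))^s], stationarity
    gives M(T) <= C (2 K^s + 2 P(X > K) M(T)). For K large the coefficient of
    M(T) is at most 1/2 and, M(T) being finite, M(T) <= 4 C K^s for all T. *)
Lemma truncated_moment_bound : exists B : R, forall T : R, (0 <= T)%R ->
  \int[mb]_d (Xs T d)%:E <= B%:E.
Proof.
have [C [CE C0]] := moment_max_finite.
have eps0 : (0 < (4 * (C + 1))^-1)%R by rewrite invr_gt0; lra.
have [K K0 hK] := probability_tight mb (eval_measurable_id (vI, vO)) eps0.
exists (4 * C * K `^ s)%R => T T0.
have mXT := measurable_truncated T (@eval_measurable_id R).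
have qE : \int[mb]_d J K d = mb [set d | K < X d]%R.
  have mKX : measurable [set d | K < X d]%R.
    by apply: measurable_superlevel; exact: eval_measurable_id.
  rewrite -[RHS](congr1 mb (setIT _)) -integral_indic//.
  apply: eq_integral => d _; rewrite /J /= indicE; congr (_%:R%:E); congr nat_of_bool.
  by apply/idP/idP; rewrite inE.
have q0 : 0 <= \int[mb]_d J K d by exact: integral_ge0.
have M0 : 0 <= \int[mb]_d (Xs T d)%:E by exact: integral_ge0.
have Mfin : \int[mb]_d (Xs T d)%:E \is a fin_num.
  rewrite ge0_fin_numE//; apply: (@le_lt_trans _ _ (\int[mb]_d (T `^ s)%:E)).
    apply: ge0_le_integral => //.
    move=> d _; rewrite lee_fin; apply: ge0_ler_powR; rewrite ?nnegrE//; first exact: ltW.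
      by rewrite le_min T0 andbT; exact: dist_IO_ge0.
    by rewrite ge_min lexx orbT.
  by rewrite integral_cst// [X in _ * X](_ : _ = 1) ?mule1 ?ltry//; exact: probability_setT.
pose zeta (z : posreals R) := ((2 * Num.max 1 (rval l * rval z)) `^ s)%:E.
have mzeta : measurable_fun setT zeta.
  apply/measurable_EFinP; apply: measurableT_comp (@measurable_powR R s) _.
  apply: measurable_funM => //; apply: measurable_maxr => //.
  by apply: measurable_funM => //; exact: measurable_rval.
have zeta0 z : 0 <= zeta z by rewrite lee_fin powR_ge0.
pose pair (p : metrics R * metrics R * metrics R * metrics R) :=
  (Xs T p.1.1.1)%:E * J K p.1.1.2 + (Xs T p.1.2)%:E * J K p.2.
have pair0 p : 0 <= pair p by rewrite adde_ge0// mule_ge0.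
have mX' (i : 'I_4) : measurable_fun setT
    (fun p : metrics R * metrics R * metrics R * metrics R => (Xs T (quad p i))%:E).
  exact: measurableT_comp mXT (measurable_quad i).
have mJ' (i : 'I_4) : measurable_fun setT
    (fun p : metrics R * metrics R * metrics R * metrics R => J K (quad p i)).
  exact: measurableT_comp (mJ K) (measurable_quad i).
have mpair : measurable_fun setT pair.
  apply: emeasurable_funD; apply: emeasurable_funM.
  - exact: (mX' (@Ordinal 4 0 isT)).
  - exact: (mJ' (@Ordinal 4 1 isT)).
  - exact: (mX' (@Ordinal 4 2 isT)).
  - exact: (mJ' (@Ordinal 4 3 isT)).
pose G p := (2 * K `^ s)%:E + pair p.
have KS0 : (0 <= 2 * K `^ s)%R by rewrite mulr_ge0// powR_ge0.
have G0 p : 0 <= G p by rewrite adde_ge0.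
have mG : measurable_fun setT G by exact: emeasurable_funD.
have step : \int[mb]_d (Xs T d)%:E <= \int[law]_p (G p.1 * zeta p.2).
  rewrite (stationary_integral mb_stationary mXT)//; last first.
    exact: (measurable_truncated T (eval_measurable_Rlambda l)).
  apply: ge0_le_integral => //.
  - exact: (measurable_truncated T (eval_measurable_Rlambda l)).
  - apply: emeasurable_funM; first exact: measurableT_comp mG measurable_fst.
    exact: measurableT_comp mzeta measurable_snd.
  move=> p _; rewrite /G /pair /zeta /J -!EFinM lee_fin.
  have X0 := @dist_IO_ge0 R.
  have lz0 : (0 <= rval l * rval p.2)%R by rewrite mulr_ge0// ltW// rval_gt0.
  set m1 := Num.min (X p.1.1.1.1) (X p.1.1.1.2).
  set m2 := Num.min (X p.1.1.2) (X p.1.2).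
  have m10 : (0 <= m1)%R by rewrite le_min !X0.
  have m20 : (0 <= m2)%R by rewrite le_min !X0.
  apply: (@le_trans _ _ (Num.min (rval l * rval p.2 * (m1 + m2)) T `^ s)%R).
    apply: ge0_ler_powR; rewrite ?nnegrE//; first exact: ltW.
    - by rewrite le_min X0.
    - by rewrite le_min T0 mulr_ge0// addr_ge0.
    by rewrite le_min !ge_min lexx dist_IO_Rlambda orbT.
  apply: le_trans (powR_truncated_sum s_gt0 lz0 m10 m20 T0) _.
  rewrite [leRHS]mulrC ler_wpM2l ?powR_ge0//.
  have := powR_truncated_min s_gt0 (X0 p.1.1.1.1) (X0 p.1.1.1.2) T0 (ltW K0).
  have := powR_truncated_min s_gt0 (X0 p.1.1.2) (X0 p.1.2) T0 (ltW K0).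
  rewrite -/m1 -/m2 /Xs; lra.
have CE' : \int[m]_z zeta z = C%:E by [].
rewrite (@integral_prodM _ _ _ _ _ mb4 m G zeta)// CE' in step.
have GE : \int[mb4]_p G p = (2 * K `^ s)%:E + 2 * (\int[mb]_d (Xs T d)%:E * \int[mb]_d J K d).
  rewrite ge0_integralD// integral_cst// [X in _ * X + _](_ : _ = 1) ?mule1; last exact: probability_setT.
  by congr (_ + _); exact: integral_truncated_pair.
rewrite GE qE in step; move: step; move: (\int[mb]_d (Xs T d)%:E) Mfin M0 => M.
case: M => // M _; rewrite lee_fin => M0.
have qfin : mb [set d | K < X d]%R \is a fin_num by rewrite fin_num_measure//; apply: measurable_superlevel; exact: eval_measurable_id.
rewrite -qE in qfin hK *; move: (\int[mb]_d J K d) qfin hK q0 => q.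
case: q => // q _; rewrite !lee_fin => hK q0.
move=> step.
have h1 : (C * q <= 4^-1)%R.
  apply: (@le_trans _ _ (C * (4 * (C + 1))^-1)%R); first exact: ler_wpM2l.
  rewrite invfM mulrCA ler_piMr// ?invr_ge0// ler_pdivrMr; lra.
have : (M * (C * q) <= M * 4^-1)%R by exact: ler_wpM2l.
by move: step; lra.
Qed.

(** The truncated moments increase to the moment and are uniformly bounded. *)
Lemma stationary_moment : \int[mb]_d (X d `^ s)%:E < +oo.
Proof.
have [B hB] := truncated_moment_bound.
pose g n d : \bar R := (Xs n%:R d)%:E.
have mg n : measurable_fun setT (g n) := measurable_truncated n%:R (@eval_measurable_id R).
have g0 n d : 0 <= g n d by exact: Xs_ge0.
have gX d : (fun n => g n d) @ \oo --> (X d `^ s)%:E.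
  apply: cvg_near_cst; exists (Num.bound (X d)) => // n /= hn; rewrite /g /Xs.
  congr (_ `^ _)%:E; apply/min_idPl.
  apply: le_trans (ltW (archi_boundP (dist_IO_ge0 d))) _.
  by rewrite ler_nat.
apply: (@le_lt_trans _ _ B%:E); last exact: ltry.
rewrite (_ : \int[mb]_d (X d `^ s)%:E = \int[mb]_d limn (g^~ d)); last first.
  by apply: eq_integral => d _; apply/esym/cvg_lim => //; exact: gX.
rewrite monotone_convergence//.
- apply: lime_le; last by near=> n; exact: hB.
  apply: ereal_nondecreasing_is_cvgn => n k nk; apply: ge0_le_integral => // d _.
  rewrite lee_fin; apply: ge0_ler_powR; rewrite ?nnegrE//; first exact: ltW.
  + by rewrite le_min dist_IO_ge0 ler0n.
  + by rewrite le_min dist_IO_ge0 ler0n.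
  + by rewrite le_min !ge_min lexx ler_nat nk !orbT.
- move=> d _ n k nk; rewrite lee_fin; apply: ge0_ler_powR; rewrite ?nnegrE//; first exact: ltW.
  + by rewrite le_min dist_IO_ge0 ler0n.
  + by rewrite le_min dist_IO_ge0 ler0n.
  + by rewrite le_min !ge_min lexx ler_nat nk !orbT.
Unshelve. all: by end_near. Qed.

End moments.

(** * Decay of the edge lengths *)

(** Built from the outermost copy, the last letter, so that the sum over
    generation [n.+1] splits along the four copies. *)
Fixpoint words (n : nat) : seq (seq 'I_4) :=
  if n is n'.+1 then [seq rcons w i | w <- words n', i <- enum 'I_4] else [:: [::]].

Lemma mem_words w : w \in words (size w).
Proof.
elim/last_ind: w => [|w i IH]; first by rewrite mem_seq1.
by rewrite size_rcons; apply/allpairsP; exists (w, i); split => //; exact: mem_enum.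
Qed.

Section edge_sums.
Context (R : realType) (s : R).
Hypothesis s_gt0 : 0 < s.

Definition edge_sum n (d : metrics R) : R := \sum_(w <- words n) mval d (ends w) `^ s.

Lemma edge_sum_ge0 n d : 0 <= edge_sum n d.
Proof. by apply: sumr_ge0 => w _; exact: powR_ge0. Qed.

Lemma edge_sum_ge d w : mval d (ends w) `^ s <= edge_sum (size w) d.
Proof.
rewrite /edge_sum (perm_big _ (perm_to_rem (mem_words w))) big_cons /= lerDl.
by apply: sumr_ge0 => w' _; exact: powR_ge0.
Qed.

Lemma measurable_edge_sum dT (T : measurableType dT) (f : T -> metrics R) n :
  eval_measurable f -> measurable_fun setT (fun t => (edge_sum n (f t))%:E).
Proof.
move=> mf; apply/measurable_EFinP; apply: measurable_sum => w.
apply: (measurableT_comp (@measurable_powR R s)); exact: mf.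
Qed.

(** Glueing can only shorten the distances inside a copy. *)
Lemma edge_sum_Rlambda (l : posreals R) (p : Rlambda_dom R) n :
  edge_sum n.+1 (Rlambda l p) <=
  (rval l * rval p.2) `^ s * \sum_(i < 4) edge_sum n (quad p.1 i).
Proof.
rewrite /edge_sum [words n.+1]/= big_allpairs_dep exchange_big /= big_enum /=.
rewrite mulr_sumr; apply: ler_sum => i _; rewrite mulr_sumr; apply: ler_sum => w _.
have lz0 : 0 <= rval l * rval p.2 by rewrite mulr_ge0// ltW// rval_gt0.
have m0 : 0 <= mval (quad p.1 i) (ends w).
  by rewrite (surjective_pairing (ends w)) mval_ge0.
rewrite -powRM// ends_rcons; apply: ge0_ler_powR; rewrite ?nnegrE.
- exact: ltW.
- exact: mval_ge0.
- exact: mulr_ge0.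
- by apply: le_trans (Rlambda_le_step _ _ _ _ _) _; rewrite -surjective_pairing.
Qed.

End edge_sums.

Section stationary_decay.
Context (R : realType) (l : posreals R) (m : probability (posreals R) R)
  (mb : probability (metrics R) R).
Hypothesis mb_stationary : forall A, measurable A -> Phi l m mb A = mb A.
Variables s rho : R.
Hypothesis s_gt0 : (0 < s)%R.
Local Open Scope ereal_scope.
Hypothesis xi_moment : \int[m]_z ((rval l * rval z) `^ s)%:E = (rho / 4)%:E.

Local Notation mb4 := (((mb \x mb) \x mb) \x mb).
Local Notation law := (mb4 \x m).

Lemma integral_edge_sumS n :
  \int[mb]_d (edge_sum s n.+1 d)%:E <= rho%:E * \int[mb]_d (edge_sum s n d)%:E.
Proof.
have F0 k d : 0 <= (edge_sum s k d)%:E by rewrite lee_fin edge_sum_ge0.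
have mF := measurable_edge_sum s n (@eval_measurable_id R).
pose G (p : metrics R * metrics R * metrics R * metrics R) : \bar R :=
  \sum_(i < 4) (edge_sum s n (quad p i))%:E.
have mGi i : measurable_fun setT
    (fun p : metrics R * metrics R * metrics R * metrics R => (edge_sum s n (quad p i))%:E).
  exact: measurableT_comp mF (measurable_quad i).
have mG : measurable_fun setT G by apply: emeasurable_sum.
have G0 p : 0 <= G p by apply: sume_ge0.
pose zeta (z : posreals R) := ((rval l * rval z) `^ s)%:E.
have zeta0 z : 0 <= zeta z by rewrite lee_fin powR_ge0.
have mzeta : measurable_fun setT zeta.
  apply/measurable_EFinP; apply: measurableT_comp (@measurable_powR R s) _.
  by apply: measurable_funM => //; exact: measurable_rval.
rewrite (stationary_integral mb_stationary)//; last 2 first.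
- exact: measurable_edge_sum (@eval_measurable_id R).
- exact: measurable_edge_sum (eval_measurable_Rlambda l).
apply: (@le_trans _ _ (\int[law]_p (G p.1 * zeta p.2))).
  apply: ge0_le_integral => //.
  - exact: measurable_edge_sum (eval_measurable_Rlambda l).
  - apply: emeasurable_funM; first exact: measurableT_comp mG measurable_fst.
    exact: measurableT_comp mzeta measurable_snd.
  move=> p _; rewrite /G /zeta sumEFin -EFinM lee_fin mulrC.
  exact: edge_sum_Rlambda.
rewrite (@integral_prodM _ _ _ _ _ mb4 m G zeta)//.
have -> : \int[m]_z zeta z = (rho / 4)%:E by [].
have -> : \int[mb4]_p G p = 4%:E * \int[mb]_d (edge_sum s n d)%:E.
  rewrite ge0_integral_sum//.
  under eq_bigr => i _ do rewrite (integral_quad mb i mF)//.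
  by rewrite big_const_ord /= !mule_natl /= adde0 !addeA.
rewrite muleAC -EFinM.
by have -> : (4 * (rho / 4) = rho)%R by field.
Qed.

Lemma rate_ge0 : (0 <= rho)%R.
Proof.
have : 0 <= (rho / 4)%:E by rewrite -xi_moment; apply: integral_ge0 => z _; rewrite lee_fin powR_ge0.
by rewrite lee_fin; lra.
Qed.

Lemma integral_edge_sum : exists B : R, forall n,
  \int[mb]_d (edge_sum s n d)%:E <= (B * rho ^+ n)%:E.
Proof.
have F0 k d : 0 <= (edge_sum s k d)%:E by rewrite lee_fin edge_sum_ge0.
have fin : \int[mb]_d (edge_sum s 0 d)%:E < +oo.
  have -> : \int[mb]_d (edge_sum s 0 d)%:E = \int[mb]_d (dist_IO d `^ s)%:E.
    by apply: eq_integral => d _; rewrite /edge_sum /= big_seq1.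
  by apply: (stationary_moment mb_stationary s_gt0); rewrite xi_moment ltry.
exists (fine (\int[mb]_d (edge_sum s 0 d)%:E)); elim=> [|n IH].
  by rewrite expr0 mulr1 fineK// ge0_fin_numE//; exact: integral_ge0.
apply: le_trans (integral_edge_sumS n) _.
apply: le_trans (lee_wpmul2l _ IH) _; first by rewrite lee_fin rate_ge0.
by rewrite -EFinM lee_fin exprS mulrCA.
Qed.

(** The series of the [r ^- (s * n)] times the edge sums of generation [n] has
    a finite expectation, hence is almost surely finite, and each of its terms
    bounds the length of every edge of its generation. *)
Lemma stationary_decay r : (0 < r < 1)%R -> (rho < r `^ s)%R ->
  {ae mb, forall d, exists2 C : R, (0 <= C)%R & decay (mval d) C r}.
Proof.
move=> /andP[r0 r1] rho_r; have [B hB] := integral_edge_sum.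
set t := (r `^ s)%R in rho_r; have t0 : (0 < t)%R by exact: powR_gt0.
have F0 k d : 0 <= (edge_sum s k d)%:E by rewrite lee_fin edge_sum_ge0.
have mF k := measurable_edge_sum s k (@eval_measurable_id R).
pose g n d : \bar R := (t ^- n)%:E * (edge_sum s n d)%:E.
have tn0 n : (0 <= t ^- n)%R by rewrite invr_ge0 exprn_ge0// ltW.
have g0 n d : 0 <= g n d by rewrite mule_ge0 ?lee_fin ?edge_sum_ge0.
have mg n : measurable_fun setT (g n) by exact: emeasurable_funM.
pose S d := \sum_(0 <= n <oo) g n d.
have mS : measurable_fun setT S by apply: ge0_emeasurable_sum.
have S0 d : 0 <= S d by apply: nneseries_ge0.
have rho0 := rate_ge0.
have q0 : (0 <= rho / t)%R by rewrite divr_ge0// ltW.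
have q1 : (`|rho / t| < 1)%R by rewrite ger0_norm// ltr_pdivrMr// mul1r.
have IS : \int[mb]_d S d < +oo.
  rewrite /S integral_nneseries//.
  apply: (@le_lt_trans _ _ (\sum_(0 <= n <oo) (`|B| * (rho / t) ^+ n)%:E)).
    apply: lee_nneseries => [n *|n *]; first by apply: integral_ge0 => d _; exact: g0.
    rewrite /g ge0_integralZl ?lee_fin//.
    apply: le_trans (lee_wpmul2l _ (hB n)) _; first by rewrite lee_fin.
    rewrite -EFinM lee_fin expr_div_n mulrCA (mulrC (t ^- n)%R).
    by rewrite -expr_div_n ler_wpM2r ?ler_norm// exprn_ge0.
  have -> : \sum_(0 <= n <oo) (`|B| * (rho / t) ^+ n)%:E =
      limn (EFin \o series (geometric `|B|%R (rho / t)%R)).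
    by apply: congr_lim; apply/funext => k; rewrite /= sumEFin.
  by rewrite EFin_lim ?ltry//; exact: is_cvg_geometric_series.
have iS : mb.-integrable setT S.
  apply/integrableP; split => //.
  by under eq_integral do rewrite gee0_abs//.
have := integrable_ae measurableT iS; apply: filterS => d /(_ I) Sfin.
have fS0 : (0 <= fine (S d))%R by exact: fine_ge0.
exists (fine (S d) `^ s^-1)%R; first exact: powR_ge0.
move=> w; set x := mval d (ends w).
have x0 : (0 <= x)%R by rewrite /x (surjective_pairing (ends w)) mval_ge0.
have h1 : (edge_sum s (size w) d <= fine (S d) * t ^+ size w)%R.
  rewrite -ler_pdivrMr ?exprn_gt0// mulrC -lee_fin fineK// EFinM.
  apply: le_trans (nneseries_lim_ge (size w).+1 _) => //.
  by rewrite big_nat_recr//= leeDr// sume_ge0.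
have h2 := le_trans (edge_sum_ge s d w) h1.
have -> : x = ((x `^ s) `^ s^-1)%R by rewrite -powRrM divff ?gt_eqF// powRr1.
have -> : (r ^+ size w = (t ^+ size w) `^ s^-1)%R.
  rewrite -[in RHS]powR_mulrn ?ltW// /t -!powRrM mulrCA divff ?gt_eqF// mulr1.
  by rewrite powR_mulrn// ltW.
have tw0 : (0 <= t ^+ size w)%R by rewrite exprn_ge0// ltW.
rewrite -powRM//; apply: ge0_ler_powR; rewrite ?nnegrE ?powR_ge0 ?mulr_ge0//.
by rewrite invr_ge0 ltW.
Qed.

End stationary_decay.

(** * The normal law under translations and its subsolutions *)

Section lebesgue_isometries.
Context (R : realType).
Local Notation mu := (@lebesgue_measure R).
Local Open Scope ereal_scope.

Lemma ge0_integralN (f : R -> \bar R) : measurable_fun [set: R] f ->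
  (forall x, 0 <= f x) -> \int[mu]_x f (- x)%R = \int[mu]_x f x.
Proof.
move=> mf f0.
have := @ge0_integral_pushforward _ _ (measurableTypeR R) (measurableTypeR R) R
  -%R (@oppr_measurable R setT) mu setT f measurableT mf (fun x _ => f0 x).
rewrite preimage_setT => <-.
by apply: eq_measure_integral => A mA _; exact: lebesgue_measureN.
Qed.

Lemma lebesgue_measure_shift (c : R) (A : set R) : measurable A ->
  pushforward mu ((fun x => x + c)%R : _ -> measurableTypeR R) A = mu A.
Proof.
move=> mA.
have mc : measurable_fun [set: measurableTypeR R]
  ((fun x => x + c)%R : measurableTypeR R -> measurableTypeR R) by exact: measurable_funD.
pose X : {mfun measurableTypeR R >-> measurableTypeR R} :=
  HB.pack (fun x : R => x + c)%R (isMeasurableFun.Build _ _ _ _ _ mc).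
apply/esym.
apply: (lebesgue_measure_unique (mu := pushforward mu X)) => //= _ [[a b]] _ <-.
rewrite /pushforward /=.
have -> : (fun x : R => x + c)%R @^-1` `]a, b] = `](a - c)%R, (b - c)%R]%classic.
  by apply/seteqP; split => x /=; rewrite !in_itv /= => /andP[h1 h2]; apply/andP; split; lra.
rewrite !lebesgue_measure_itv/= !lte_fin ltrD2r.
by case: ifP => // _; rewrite -!EFinD; congr (_%:E); ring.
Qed.

Lemma ge0_integral_shift (c : R) (f : R -> \bar R) : measurable_fun [set: R] f ->
  (forall x, 0 <= f x) -> \int[mu]_x f (x + c)%R = \int[mu]_x f x.
Proof.
move=> mf f0.
have mc : measurable_fun [set: measurableTypeR R]
  ((fun x => x + c)%R : measurableTypeR R -> measurableTypeR R) by exact: measurable_funD.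
have := @ge0_integral_pushforward _ _ (measurableTypeR R) (measurableTypeR R) R
  _ mc mu setT f measurableT mf (fun x _ => f0 x).
rewrite preimage_setT => <-.
by apply: eq_measure_integral => A mA _; exact: lebesgue_measure_shift.
Qed.

End lebesgue_isometries.

Section normal_law.
Context (R : realType) (sigma : R).
Hypothesis sigma_gt0 : (0 < sigma)%R.
Local Notation mu := (@lebesgue_measure R).
Local Notation N := (normal_prob 0 sigma).
Local Notation pdf := (normal_pdf 0 sigma).
Local Open Scope ereal_scope.

(** The density is a Radon-Nikodym derivative, by uniqueness of the latter. *)
Lemma ge0_integral_normal (f : R -> \bar R) : measurable_fun [set: R] f ->
  (forall x, 0 <= f x) ->
  \int[N]_x f x = \int[mu]_x (f x * (pdf x)%:E).
Proof.
move=> mf f0.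
have dom := normal_prob_dominates 0 sigma.
have mpdf : measurable_fun [set: R] (fun x => (pdf x)%:E).
  by apply/measurable_EFinP; exact: measurable_normal_pdf.
rewrite -(Radon_Nikodym_SigmaFinite.change_of_variables dom)//.
apply: ae_eq_integral => //.
- apply: emeasurable_funM => //; apply: (measurable_int mu).
  exact: Radon_Nikodym_SigmaFinite.f_integrable.
- exact: emeasurable_funM.
- apply: ae_eqe_mul2l => /=; apply: integral_ae_eq => //=.
  + exact: Radon_Nikodym_SigmaFinite.f_integrable.
  + by move=> E _ mE; rewrite -Radon_Nikodym_SigmaFinite.f_integral.
Qed.

Let pdfE x : pdf x = (normal_peak sigma * expR (- x ^+ 2 / (sigma ^+ 2 *+ 2)))%R.
Proof. by rewrite normal_pdfE ?gt_eqF// /normal_fun subr0. Qed.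

Lemma normal_integralN (f : R -> \bar R) : measurable_fun [set: R] f ->
  (forall x, 0 <= f x) -> \int[N]_x f (- x)%R = \int[N]_x f x.
Proof.
move=> mf f0; have mN := measurableT_comp mf (@oppr_measurable R setT).
have mpdf : measurable_fun [set: R] (fun x => (pdf x)%:E).
  by apply/measurable_EFinP; exact: measurable_normal_pdf.
rewrite !ge0_integral_normal//.
rewrite -[RHS]ge0_integralN; last 2 first.
- exact: emeasurable_funM.
- by move=> x; rewrite mule_ge0// lee_fin normal_pdf_ge0.
by apply: eq_integral => x _; rewrite !pdfE sqrrN.
Qed.

(** Completing the square: translating a centred Gaussian variable amounts to
    multiplying its law by an exponential. *)
Lemma normal_cameron_martin (a : R) (f : R -> \bar R) : measurable_fun [set: R] f ->
  (forall x, 0 <= f x) ->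
  \int[N]_x f (x + a)%R =
    \int[N]_x (f x * (expR ((a * x - a ^+ 2 / 2) / sigma ^+ 2))%:E).
Proof.
move=> mf f0.
have mpdf : measurable_fun [set: R] (fun x => (pdf x)%:E).
  by apply/measurable_EFinP; exact: measurable_normal_pdf.
have ma : measurable_fun [set: R] (fun x : R => (x + a)%R) by exact: measurable_funD.
have mb : measurable_fun [set: R] (fun x : R => (x - a)%R) by exact: measurable_funB.
rewrite ge0_integral_normal//; last exact: measurableT_comp mf ma.
rewrite ge0_integral_normal; last 2 first.
- apply: emeasurable_funM => //; apply/measurable_EFinP/measurableT_comp => //.
  apply: measurable_funM => //; apply: measurable_funB => //.
- by move=> x; rewrite mule_ge0// lee_fin expR_ge0.
rewrite -[RHS](@ge0_integral_shift _ a); last 2 first.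
- apply: emeasurable_funM => //; apply: emeasurable_funM => //.
  apply/measurable_EFinP/measurableT_comp => //.
  apply: measurable_funM => //; apply: measurable_funB => //.
- by move=> x; rewrite !mule_ge0// lee_fin ?expR_ge0// normal_pdf_ge0.
apply: eq_integral => x _; rewrite -muleA -EFinM; congr (_ * _%:E).
rewrite !pdfE mulrCA -expRD; congr (_ * expR _)%R.
have s0 : sigma != 0%R by rewrite gt_eqF.
by rewrite -mulr_natr; field.
Qed.

(** The translation formula for the constant function 1. *)
Lemma normal_mgf (s : R) :
  \int[N]_x (expR (s * x))%:E = (expR (s ^+ 2 * sigma ^+ 2 / 2))%:E.
Proof.
have s0 : sigma != 0%R by rewrite gt_eqF.
have ms : measurable_fun [set: R] (fun x => (expR (s * x))%:E).
  by apply/measurable_EFinP/measurableT_comp => //; exact: measurable_funM.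
have := @normal_cameron_martin (s * sigma ^+ 2)%R (cst 1) (measurable_cst _) (fun=> lee01).
rewrite integral_cst// mul1e [X in X = _](_ : _ = 1); last exact: probability_setT.
have eqI : \int[N]_x (cst 1 x * (expR ((s * sigma ^+ 2 * x - (s * sigma ^+ 2) ^+ 2 / 2)
    / sigma ^+ 2))%:E) = \int[N]_x ((expR (- (s ^+ 2 * sigma ^+ 2 / 2)))%:E * (expR (s * x))%:E).
  by apply: eq_integral => x _; rewrite mul1e -EFinM -expRD; congr (expR _)%:E; field.
rewrite eqI ge0_integralZl//.
have key (c : R) (I : \bar R) : 1 = (expR (- c))%:E * I -> I = (expR c)%:E.
  move=> h; rewrite -[LHS]mul1e -(expR0 R) -(subrr c) expRD EFinM.
  by rewrite -muleA -h mule1.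
exact: key.
Qed.

End normal_law.

Section tent.
Context (R : realType).
Implicit Types L B x y eta : R.

Definition tent L y : R := Num.max 0 (L - `|y|).

Lemma tent_ge0 L y : 0 <= tent L y. Proof. by rewrite /tent le_max lexx. Qed.

Lemma tent_ge L y : L - `|y| <= tent L y.
Proof. by rewrite /tent le_max lexx orbT. Qed.

Lemma tent_le L y : 0 <= L -> tent L y <= L.
Proof. by move=> L0; rewrite /tent ge_max L0 lerBlDr lerDl normr_ge0. Qed.

Lemma tent0 L : 0 <= L -> tent L 0 = L.
Proof. by move=> L0; rewrite /tent normr0 subr0 max_r. Qed.

Lemma tent_eq0 L y : L <= `|y| -> tent L y = 0.
Proof. by move=> h; rewrite /tent max_l// subr_le0. Qed.

Lemma measurable_tent L : measurable_fun [set: R] (tent L).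
Proof.
apply: (@measurable_maxr _ _ _ _ (cst 0)) => //.
apply: measurable_funB => //; exact: normr_measurable.
Qed.

(** The tent is convex away from its top, in particular near its ends where a
    relative loss would be fatal; within [B] of its top it varies by a fraction
    [eta] of its value. *)
Lemma tent_almost_midconvex eta B y x : 0 < eta -> 0 < B -> `|x| <= B ->
  2 * ((1 - eta) * tent (B + B / eta) y) <=
  tent (B + B / eta) (y - x) + tent (B + B / eta) (y + x).
Proof.
move=> eta0 B0 xB; set L := B + B / eta.
have LE : eta * (L - B) = B by rewrite /L addrAC subrr add0r mulrC divfK ?gt_eqF.
have [yL|yL] := leP L `|y|.
  by rewrite (tent_eq0 yL) !mulr0 addr_ge0// tent_ge0.
have tyE : tent L y = L - `|y| by rewrite /tent max_r// subr_ge0 ltW.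
have h1 := tent_ge L (y - x); have h2 := tent_ge L (y + x).
have t0 : 0 <= tent L y by exact: tent_ge0.
have shrink : (1 - eta) * tent L y <= tent L y.
  by rewrite mulrBl mul1r lerBlDr lerDl mulr_ge0// ltW.
have [yB|yB] := leP B `|y|.
  apply: le_trans (lerD h1 h2); apply: le_trans (ler_wpM2l _ shrink) _ => //.
  rewrite tyE; move: xB yB; rewrite ler_norml => /andP[x1 x2].
  have [y0|y0] := leP 0 y.
    rewrite ger0_norm// => yB.
    by rewrite !ger0_norm; lra.
  rewrite ltr0_norm// => yB.
  by rewrite !ler0_norm; lra.
have n1 := ler_normB y x; have n2 := ler_normD y x.
have : eta * (L - B) <= eta * tent L y by rewrite ler_pM2l// tyE; lra.
by rewrite LE mulrBl mul1r tyE in h1 h2 *; move: h1 h2; lra.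
Qed.

End tent.

Section subsolution.
Context (R : realType) (sigma : R).
Hypothesis sigma_gt0 : (0 < sigma)%R.
Local Notation N := (normal_prob 0 sigma).
Local Open Scope ereal_scope.

Lemma normal_concentration (eta : R) : (0 < eta)%R ->
  exists2 B : R, (0 < B)%R & (1 - eta)%:E <= N `[(- B)%R, B]%classic.
Proof.
move=> eta0; pose F (n : nat) : set (measurableTypeR R) := `[(- n%:R)%R, n%:R%R]%classic.
have NF : N \o F @ \oo --> N (\bigcup_n F n).
  have mF n : measurable (F n) by exact: measurable_itv.
  apply: nondecreasing_cvg_mu => //; first exact: bigcupT_measurable.
  move=> n m nm; apply/subsetPset => x; rewrite /F /= !in_itv /= => /andP[h1 h2].
  have : (n%:R <= m%:R :> R)%R by rewrite ler_nat.
  by move=> ?; apply/andP; split; lra.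
have FT : \bigcup_n F n = setT.
  apply/seteqP; split => // x _; exists (Num.bound `|x|%R) => //; rewrite /F /= in_itv /=.
  by rewrite -ler_norml ltW// archi_boundP.
apply: contrapT => hno.
have : limn (N \o F) <= (1 - eta)%:E.
  apply: lime_le; first by apply/cvg_ex; eexists; exact: NF.
  exists 1%N => // n /= n0; rewrite leNgt; apply/negP => h; apply: hno.
  by exists n%:R; [rewrite ltr0n|exact: ltW].
rewrite (cvg_lim _ NF)// FT [X in X <= _](_ : _ = 1); last exact: probability_setT.
by rewrite lee_fin; lra.
Qed.

Lemma normal_tail_gt0 (c : R) : 0 < N `[c, +oo[%classic.
Proof.
(* A lower bound for the density on the interval from [c] to [c + 1]. *)
pose b : R := (normal_peak sigma * expR (- (`|c| + 1) ^+ 2 / (sigma ^+ 2 *+ 2)))%R.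
have b0 : (0 < b)%R by rewrite mulr_gt0 ?expR_gt0// normal_peak_gt0// gt_eqF.
apply: (@lt_le_trans _ _ (N `[c, (c + 1)%R]%classic)); last first.
  by apply: le_measure; rewrite ?inE// => x /=; rewrite !in_itv /= => /andP[-> _].
apply: (@lt_le_trans _ _ b%:E); first by rewrite lte_fin.
rewrite /normal_prob.
apply: (@le_trans _ _ (\int[lebesgue_measure]_(x in `[c, (c + 1)%R]%classic) b%:E)).
  rewrite integral_cst//= lebesgue_measure_itv/= lte_fin ltrDl ltr01 -EFinD.
  by rewrite addrAC subrr add0r mule1.
apply: ge0_le_integral => //.
- by move=> x _; rewrite lee_fin ltW.
- by apply/measurable_EFinP/measurable_funTS; exact: measurable_normal_pdf.
move=> x /=; rewrite in_itv /= => /andP[cx xc].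
rewrite lee_fin normal_pdfE ?gt_eqF// /normal_fun subr0 ler_pM2l; last first.
  by rewrite normal_peak_gt0// gt_eqF.
rewrite ler_expR ler_pM2r ?invr_gt0 ?pmulrn_lgt0 ?exprn_gt0// lerN2.
rewrite -[leLHS]real_normK ?num_real// ler_pXn2r ?nnegrE ?addr_ge0//.
have := ler_norm c; have := ler_norm (- c); rewrite normrN ler_norml => ? ?.
by apply/andP; split; lra.
Qed.

(** By symmetry of the law, [tent L (y - x)] may be averaged with
    [tent L (y + x)]; steps of size at most [B] carry most of the mass. *)
Lemma normal_tent (eta : R) : (0 < eta)%R -> (eta < 1)%R ->
  exists2 L : R, (0 < L)%R & forall y,
    ((1 - eta) ^+ 2 * tent L y)%:E <= \int[N]_x (tent L (y - x))%:E.
Proof.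
move=> eta0 eta1; have [B B0 hB] := normal_concentration eta0.
exists (B + B / eta)%R => [|y]; first by rewrite addr_gt0// divr_gt0.
set L := (B + B / eta)%R.
have mt : measurable_fun [set: R] (fun x => (tent L (y - x))%:E).
  apply/measurable_EFinP; apply: measurableT_comp (measurable_tent L) _.
  exact: measurable_funB.
have mt' : measurable_fun [set: R] (fun x => (tent L (y + x))%:E).
  apply/measurable_EFinP; apply: measurableT_comp (measurable_tent L) _.
  exact: measurable_funD.
have t0 z : 0 <= (tent L z)%:E by rewrite lee_fin tent_ge0.
have sym : \int[N]_x (tent L (y + x))%:E = \int[N]_x (tent L (y - x))%:E.
  by rewrite -(normal_integralN sigma_gt0 mt').
pose K : set (measurableTypeR R) := `[(- B)%R, B]%classic.
have mK : measurable K by exact: measurable_itv.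
have c0 : (0 <= 2 * ((1 - eta) * tent L y))%R.
  by rewrite !mulr_ge0 ?tent_ge0// subr_ge0 ltW.
have : \int[N]_x ((2 * ((1 - eta) * tent L y))%:E * (\1_K x)%:E) <=
    \int[N]_x ((tent L (y - x))%:E + (tent L (y + x))%:E).
  apply: ge0_le_integral => //.
  - by move=> x _; rewrite -EFinM lee_fin mulr_ge0.
  - apply: emeasurable_funM => //; exact/measurable_EFinP.
  - exact: emeasurable_funD.
  - move=> x _; rewrite -EFinM -EFinD lee_fin indicE.
    case: (boolP (x \in K)) => [|_]; last by rewrite mulr0 addr_ge0// tent_ge0.
    rewrite inE /K /= in_itv /= -ler_norml mulr1 => xB.
    exact: tent_almost_midconvex.
rewrite ge0_integralD// sym ge0_integralZl//; last first.
- exact/measurable_EFinP.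
rewrite integral_indic// setIT => h.
rewrite -(@lee_pmul2l _ 2%:E)//.
rewrite [leRHS]mule_natl mule2n; apply: le_trans h.
apply: le_trans (lee_wpmul2l _ hB); last by rewrite lee_fin.
by rewrite -!EFinM lee_fin le_eqVlt; apply/orP; left; apply/eqP; ring.
Qed.

(** The exponential factor is the tilt that turns Gaussian steps of drift [a]
    into centred ones, leaving a tent to deal with. *)
Definition bump (a L y : R) : R := (expR (a * y / sigma ^+ 2) * tent L y)%R.

Lemma bump_ge0 a L y : (0 <= bump a L y)%R.
Proof. by rewrite mulr_ge0 ?expR_ge0 ?tent_ge0. Qed.

(** The factor [expR (- (a ^+ 2 / 2) / sigma ^+ 2)] is the large deviation cost
    for a step to compensate the drift [a]. *)
Lemma normal_bump (eta : R) : (0 < eta)%R -> (eta < 1)%R ->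
  exists2 L : R, (0 < L)%R & forall a y,
    (expR (- (a ^+ 2 / 2) / sigma ^+ 2) * (1 - eta) ^+ 2 * bump a L y)%:E <=
    \int[N]_x (bump a L (y - a - x))%:E.
Proof.
move=> eta0 eta1; have [L L0 hL] := normal_tent eta0 eta1; exists L => // a y.
have mb : measurable_fun [set: R] (fun x => (bump a L (y - x))%:E).
  apply/measurable_EFinP; apply: measurable_funM.
    apply: measurableT_comp => //; apply: measurable_funM => //; apply: measurable_funM => //.
    exact: measurable_funB.
  apply: measurableT_comp (measurable_tent L) _; exact: measurable_funB.
have b0 x : 0 <= (bump a L (y - x))%:E by rewrite lee_fin bump_ge0.
have -> : \int[N]_x (bump a L (y - a - x))%:E = \int[N]_x (bump a L (y - (x + a)))%:E.
  by apply: eq_integral => x _; congr (bump _ _ _)%:E; ring.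
rewrite (normal_cameron_martin sigma_gt0 a mb b0).
have mt : measurable_fun [set: R] (fun x => (tent L (y - x))%:E).
  apply/measurable_EFinP; apply: measurableT_comp (measurable_tent L) _.
  exact: measurable_funB.
pose c := (expR (- (a ^+ 2 / 2) / sigma ^+ 2) * expR (a * y / sigma ^+ 2))%R.
have c0 : (0 < c)%R by rewrite mulr_gt0// expR_gt0.
have -> : \int[N]_x ((bump a L (y - x))%:E *
    (expR ((a * x - a ^+ 2 / 2) / sigma ^+ 2))%:E) =
    c%:E * \int[N]_x (tent L (y - x))%:E.
  rewrite -ge0_integralZl//; last 2 first.
  - by move=> x _; rewrite lee_fin tent_ge0.
  - by rewrite lee_fin ltW.
  apply: eq_integral => x _; rewrite -!EFinM /bump /c; congr _%:E.
  rewrite mulrAC -expRD -expRD; congr (expR _ * _)%R.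
  have s0 : sigma != 0%R by rewrite gt_eqF.
  by field.
have -> : (expR (- (a ^+ 2 / 2) / sigma ^+ 2) * (1 - eta) ^+ 2 * bump a L y =
   c * ((1 - eta) ^+ 2 * tent L y))%R by rewrite /c /bump; ring.
by rewrite EFinM lee_pmul2l// ?lte_fin.
Qed.

End subsolution.

(** * The supercritical regime *)

Section heights.
Context (R : realType).
Implicit Types d : metrics R.

(** The distance to the pair of glueing points. A path from a copy to the
    glueing points of the whole space first leaves the copy, so this quantity,
    unlike other distances, does not decrease by glueing. *)
Definition height v d : R := Num.min (mval d (v, vI)) (mval d (v, vO)).

Lemma height_lip d b q : height b d <= mval d (b, q) + height q d.
Proof.
have [_ _ _ dt] := mvalP d; rewrite /height.
have := dt q b vI; have := dt q b vO.
by case: (leP (mval d (q, vI)) (mval d (q, vO))) => _ h1 h2; rewrite ge_min; apply/orP; [left|right].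
Qed.

Lemma height_corner d b : b = vI \/ b = vO -> height b d = 0.
Proof.
have [d0 _ _ _] := mvalP d.
by move=> [->|->]; rewrite /height d0; [apply: min_l|apply: min_r]; exact: mval_ge0.
Qed.

(** Before its first passage at a glueing point, a chain stays in one copy. *)
Lemma height_glue (d : 'I_4 -> metrics R) i v y : y = vI \/ y = vO ->
  height v (d i) <= Defs.glue d (copy i v, y).
Proof.
move=> hy; apply: le_glue => s; elim: s v => [|[[j p] q] s IH] v /=.
  move=> vy; rewrite height_corner ?cost_ge0//; move: hy; rewrite -vy.
  by case: v {vy} => [||w] /=; [left|right|case].
move=> [vE hs].
case: v vE => [vE|vE|w vE].
- by rewrite height_corner ?cost_ge0//; left.
- by rewrite height_corner ?cost_ge0//; right.
have [ji pE] : j = i /\ p = vMid w.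
  by rewrite -[w]cats0; apply: copy_inner; rewrite -vE -rcons_cat cats0.
subst j p; rewrite /cost big_cons /=.
by apply: le_trans (height_lip _ _ q) _; rewrite lerD2l; exact: IH.
Qed.

Lemma height_Rlambda (l : posreals R) (p : Rlambda_dom R) i v :
  rval l * rval p.2 * height v (quad p.1 i) <= height (copy i v) (Rlambda l p).
Proof.
rewrite {2}/height /Rlambda /mval /= le_min !ler_pM2l ?mulr_gt0 ?rval_gt0//.
by rewrite !height_glue//; [right|left].
Qed.

Definition tall (t : R) : set (metrics R) := [set d | exists v, t < height v d].

Lemma measurable_tall dT (T : measurableType dT) (f : T -> metrics R) t :
  eval_measurable f -> measurable [set x | tall t (f x)].
Proof.
move=> mf; have -> : [set x | tall t (f x)] = \bigcup_v [set x | t < height v (f x)].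
  by apply/seteqP; split=> x [v]; [exists v|move=> _ hv; exists v].
apply: measurable_bigcup_countType => v; apply: measurable_superlevel.
by apply: measurable_minr; exact: mf.
Qed.

Lemma tall_le t t' d : t <= t' -> tall t' d -> tall t d.
Proof. by move=> tt [v hv]; exists v; exact: le_lt_trans hv. Qed.

Lemma tall_diam d : (forall t, tall t d) -> diam [set: completion d] = +oo%E.
Proof.
move=> ht; apply/eqyP => t _; have [v] := ht t.
rewrite /height lt_min => /andP[hv _].
apply: (@le_trans _ _ (mdist (inclV d v) (inclV d vI))%:E).
  by rewrite inclV_isometry lee_fin ltW.
by apply: ereal_sup_ubound; right; exists (inclV d v, inclV d vI).
Qed.

(** The expansion 4 q - 6 q^2 of the probability that one of four independent
    events of probability [q] occurs is at least (4 - kappa) q for q <= kappa / 6. *)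
Lemma bonferroni4 (kappa q : R) : 0 < kappa -> kappa <= 1 -> 0 <= q -> q <= 1 ->
  (4 - kappa) * Num.min q (kappa / 6) <= 1 - (1 - q) ^+ 4.
Proof.
move=> k0 k1 q0 q1; set f := Num.min q (kappa / 6).
have fq : f <= q by rewrite ge_min lexx.
have fk : 6 * f <= kappa.
  have : f <= kappa / 6 by rewrite ge_min lexx orbT.
  lra.
have f0 : 0 <= f by rewrite le_min q0 divr_ge0// ltW.
have : (1 - q) ^+ 4 <= (1 - f) ^+ 4 by rewrite lerXn2r ?nnegrE//; lra.
suff : (4 - kappa) * f <= 1 - (1 - f) ^+ 4 by lra.
have e : 1 - (1 - f) ^+ 4 = f * (4 - 6 * f + f ^+ 2 * (4 - f)) by ring.
rewrite e mulrC ler_wpM2l//.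
have : 0 <= f ^+ 2 * (4 - f) by rewrite mulr_ge0 ?sqr_ge0//; lra.
lra.
Qed.

End heights.

Section unbounded.
Context (R : realType) (sigma : R) (l : posreals R) (mb : probability (metrics R) R).
Hypothesis sigma_gt0 : (0 < sigma)%R.
Hypothesis mb_stationary : forall A, measurable A ->
  Phi l (lognormal sigma) mb A = mb A.
Local Open Scope ereal_scope.

Local Notation m := (lognormal sigma).
Local Notation N := (normal_prob 0 sigma).
Local Notation mb4 := (((mb \x mb) \x mb) \x mb).
Local Notation law := (mb4 \x m).
Local Notation quad4 := (metrics R * metrics R * metrics R * metrics R)%type.

Lemma forall_quadE (A : set (metrics R)) :
  [set p : quad4 | forall i, A (quad p i)] = ((A `*` A) `*` A) `*` A.
Proof.
apply/seteqP; split=> [p h|p [[[h0 h1] h2] h3] [[|[|[|[|//]]]] ?]] //=.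
split; last exact: (h (@Ordinal 4 3 isT)).
split; last exact: (h (@Ordinal 4 2 isT)).
by split; [exact: (h (@Ordinal 4 0 isT))|exact: (h (@Ordinal 4 1 isT))].
Qed.

Lemma prob_forall_quad A : measurable A ->
  mb4 [set p : quad4 | forall i, A (quad p i)] = mb A * mb A * mb A * mb A.
Proof.
move=> mA; rewrite forall_quadE.
have mA2 : measurable (A `*` A) by exact: measurableX.
have mA3 : measurable (A `*` A `*` A) by exact: measurableX.
have e2 : (mb \x mb) (A `*` A) = mb A * mb A by exact: product_measure1E.
have e3 : ((mb \x mb) \x mb) (A `*` A `*` A) = mb A * mb A * mb A.
  by rewrite -e2; exact: (@product_measure1E _ _ _ _ _ (mb \x mb) mb).
by rewrite -e3; exact: (@product_measure1E _ _ _ _ _ ((mb \x mb) \x mb) mb).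
Qed.

Let pr (A : set (metrics R)) : R := fine (mb A).

Let prE A : measurable A -> mb A = (pr A)%:E.
Proof. by move=> mA; rewrite /pr fineK// fin_num_measure. Qed.

Let pr_ge0 A : (0 <= pr A)%R. Proof. by rewrite fine_ge0. Qed.

Let pr_le1 A : measurable A -> (pr A <= 1)%R.
Proof. by move=> mA; rewrite -lee_fin -prE// probability_le1. Qed.

Lemma prob_exists_quad A : measurable A ->
  mb4 [set p : quad4 | exists i, A (quad p i)] = (1 - (1 - pr A) ^+ 4)%:E.
Proof.
move=> mA; have mAC := measurableC mA.
have -> : [set p : quad4 | exists i, A (quad p i)] =
    ~` [set p | forall i, (~` A) (quad p i)].
  apply/seteqP; split => [p [i Ai] /(_ i)//|p /= /existsNP[i /contrapT Ai]].
  by exists i.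
have mE : measurable [set p : quad4 | forall i, (~` A) (quad p i)].
  rewrite forall_quadE; do 3 (apply: measurableX => //).
transitivity (1 - mb4 [set p : quad4 | forall i, (~` A) (quad p i)]).
  exact: (@probability_setC _ _ _ mb4).
rewrite prob_forall_quad//.
rewrite probability_setC// prE// -!EFinB.
by congr _%:E; ring.
Qed.

(* The tail of the supremum of the heights, in logarithmic scale. *)
Local Notation g := (fun y : R => pr (@tall R (expR y))).

Let mtall t : measurable (@tall R t).
Proof. exact: measurable_tall (@eval_measurable_id R). Qed.

Lemma tall_nonincreasing x y : (x <= y)%R -> (g y <= g x)%R.
Proof.
move=> xy; rewrite -lee_fin -!prE//; apply: le_measure; rewrite ?inE// => d.
by apply: tall_le; rewrite ler_expR.
Qed.

(** A tall copy is enough to make the glued space tall, and four independent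
    copies multiply small tail probabilities by almost 4. In logarithmic scale the
    factor [lambda xi] is a Gaussian step of drift [ln lambda]. *)
Lemma tall_supersolution (kappa : R) (h : R -> R) :
  (0 < kappa)%R -> (kappa <= 1)%R -> measurable_fun setT h ->
  (forall v, 0 <= h v)%R -> (forall v, h v <= kappa / 6)%R -> (forall v, h v <= g v)%R ->
  forall y, (4 - kappa)%:E * \int[N]_x (h (y - ln (rval l) - x))%:E <= (g y)%:E.
Proof.
move=> k0 k1 mh h0 hk hg y; rewrite -prE//.
pose E : set (Rlambda_dom R) := [set p | exists i, tall (expR y / (rval l * rval p.2)) (quad p.1 i)].
have lz (z : posreals R) : (0 < rval l * rval z)%R by rewrite mulr_gt0 ?rval_gt0.
have mE : measurable E.
  have -> : E = \bigcup_(i : 'I_4) \bigcup_v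
      [set p : Rlambda_dom R | expR y < rval l * rval p.2 * height v (quad p.1 i)]%R.
    apply/seteqP; split=> p [i].
      by move=> [v hv]; exists i => //; exists v => //=; rewrite mulrC -ltr_pdivrMr.
    move=> _ [v _ /= hv]; exists i; exists v.
    by rewrite ltr_pdivrMr// mulrC.
  apply: measurable_bigcup_countType => i; apply: measurable_bigcup_countType => v.
  apply: measurable_superlevel; apply: measurable_funM.
    by apply: measurable_funM => //; exact: measurableT_comp (@measurable_rval R) measurable_snd.
  have mq : eval_measurable (fun p : Rlambda_dom R => quad p.1 i).
    apply: eval_measurable_comp.
    exact: measurableT_comp (measurable_quad i) measurable_fst.
  by apply: measurable_minr; exact: mq.
have step1 : law E <= mb (tall (expR y)).
  rewrite (stationary_set mb_stationary)//; apply: le_measure; rewrite ?inE//.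
    exact: measurable_tall (eval_measurable_Rlambda l).
  move=> p [i [v hv]]; exists (copy i v).
  apply: lt_le_trans (height_Rlambda _ _ _ _).
  by rewrite mulrC -ltr_pdivrMr.
apply: le_trans step1.
pose F (p : Rlambda_dom R) : \bar R := (\1_E p)%:E.
have mF : measurable_fun setT F by exact/measurable_EFinP/measurable_indic.
have F0 p : 0 <= F p by rewrite lee_fin.
have -> : law E = \int[law]_p F p by rewrite /F integral_indic// setIT.
rewrite (@integral_prod_iter _ _ _ _ _ mb4 m F)//.
have mG := @measurable_integral_fst _ _ _ _ _ mb4 F mF F0.
rewrite ge0_integral_distribution//; last by move=> z; apply: integral_ge0.
have k4 : (0 <= 4 - kappa)%R by lra.
have mh' : measurable_fun [set: R] (fun x => (h (y - ln (rval l) - x))%:E).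
  by apply/measurable_EFinP; apply: measurableT_comp mh _; exact: measurable_funB.
rewrite -ge0_integralZl//; last by move=> x _; rewrite lee_fin.
apply: ge0_le_integral => //.
- by move=> x _; rewrite mule_ge0// lee_fin.
- exact: emeasurable_funM.
- exact: measurableT_comp mG (@measurable_pos_expR R).
move=> x _; rewrite /=.
have tE : (expR y / (rval l * expR x) = expR (y - ln (rval l) - x))%R.
  by rewrite !expRD !expRN lnK ?posrE ?rval_gt0// invfM mulrA.
have -> : \int[mb4]_q F (q, pos_expR x) =
    mb4 [set q : quad4 | exists i, tall (expR (y - ln (rval l) - x)) (quad q i)].
  rewrite -[RHS](congr1 mb4 (setIT _)) -integral_indic//; last first.
    have -> : [set q : quad4 | exists i, tall (expR (y - ln (rval l) - x)) (quad q i)] =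
        \bigcup_(i : 'I_4) [set q | tall (expR (y - ln (rval l) - x)) (quad q i)].
      by apply/seteqP; split=> q [i]; [exists i|move=> _ ?; exists i].
    apply: measurable_bigcup_countType => i; apply: measurable_tall.
    exact: eval_measurable_comp (measurable_quad i).
  apply: eq_integral => q _; rewrite /F !indicE; congr (_%:R%:E); congr nat_of_bool.
  by apply/idP/idP; rewrite !inE /E /= /rval /= tE.
rewrite prob_exists_quad// -EFinM lee_fin.
apply: le_trans (bonferroni4 k0 k1 (pr_ge0 _) (pr_le1 (mtall _))).
by rewrite ler_wpM2l// le_min hg hk.
Qed.


(** A metric does not vanish at distinct points. *)
Lemma tall_pos_ex : exists y, (0 < g y)%R.
Proof.
pose F (n : nat) := @tall R (expR (- n%:R)).
have mF n : measurable (F n) by exact: mtall.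
have cF : mb \o F @ \oo --> mb (\bigcup_n F n).
  apply: nondecreasing_cvg_mu => //; first exact: bigcupT_measurable.
  move=> n k nk; apply/subsetPset => d; apply: tall_le.
  by rewrite ler_expR lerN2 ler_nat.
have FT : \bigcup_n F n = setT.
  apply/seteqP; split=> // d _.
  have h0 : (0 < height (vMid [::]) d)%R by rewrite lt_min !mval_gt0.
  exists (Num.bound (`|ln (height (vMid [::]) d)|)%R) => //; exists (vMid [::]).
  rewrite -[ltRHS]lnK ?posrE// ltr_expR ltrNl.
  apply: le_lt_trans (ler_norm _) _; rewrite normrN.
  exact: archi_boundP.
rewrite FT in cF; apply: contrapT => hno.
have F0 n : mb (F n) = 0.
  rewrite prE//; congr (_%:E); apply/eqP; rewrite eq_le pr_ge0 andbT leNgt.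
  by apply/negP => h; apply: hno; exists (- n%:R)%R.
have : limn (mb \o F) = 0.
  rewrite (_ : mb \o F = cst 0) ?lim_cst//.
  by apply/funext => n; rewrite /= F0.
rewrite (cvg_lim _ cF)// [X in X = _](_ : _ = 1); last exact: probability_setT.
by move/eqP; rewrite onee_eq0.
Qed.

(** A single Gaussian step goes with positive probability from a given level
    to any other one. *)
Lemma tall_gt0 y : (0 < g y)%R.
Proof.
have [v0 gv0] := tall_pos_ex.
(* [1 / 6] is the truncation level of the recursion for [kappa = 1]. *)
pose c : R := (Num.min (g v0) (1 / 6))%R.
have c0 : (0 < c)%R by rewrite lt_min gv0; lra.
pose h (v : R) : R := (c * \1_(`]-oo, v0]%classic : set R) v)%R.
have mh : measurable_fun setT h.
  by apply: measurable_funM => //; exact: measurable_indic.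
have i01 (v : R) : (0 <= (\1_(`]-oo, v0]%classic : set R) v : R) <= 1)%R.
  by rewrite indicE; case: (_ \in _); rewrite /= ?lexx ?ler01.
have h0 v : (0 <= h v)%R by rewrite mulr_ge0 ?(ltW c0)//; case/andP: (i01 v).
have hc v : (h v <= c)%R by rewrite ler_piMr ?(ltW c0)//; case/andP: (i01 v).
have hk v : (h v <= 1 / 6)%R by apply: le_trans (hc v) _; rewrite ge_min lexx orbT.
have hg v : (h v <= g v)%R.
  have [vv|vv] := leP v v0.
    apply: le_trans (hc v) _; apply: (@le_trans _ _ (g v0)).
      by rewrite ge_min lexx.
    exact: tall_nonincreasing.
  rewrite /h indicE memNset ?mulr0 ?pr_ge0//= in_itv /=.
  by apply/negP; rewrite -ltNge.
have := tall_supersolution (@ltr01 R) (lexx _) mh h0 hk hg y.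
rewrite -lte_fin; apply: lt_le_trans; apply: mule_gt0; first by rewrite lte_fin; lra.
set b := (y - ln (rval l))%R.
have -> : \int[N]_x (h (b - x))%:E = c%:E * N `[(b - v0)%R, +oo[%classic.
  transitivity (c%:E * \int[N]_x (\1_(`[(b - v0)%R, +oo[%classic : set (measurableTypeR R)) x)%:E).
    have c0' : 0 <= c%:E by rewrite lee_fin ltW.
    rewrite -ge0_integralZl//; last exact/measurable_EFinP/measurable_indic.
    apply: eq_integral => x _; rewrite /h EFinM !indicE; congr (_ * (_%:R)%:E).
    congr nat_of_bool; apply/idP/idP; rewrite !inE /= !in_itv /= ?andbT; lra.
  by rewrite integral_indic// setIT.
by rewrite mule_gt0 ?lte_fin//; exact: normal_tail_gt0.
Qed.

Hypothesis supercritical : (0 < gamma_BRW sigma + ln (rval l))%R.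

(** As the tail is nonincreasing, a positive drift may be replaced with 0. A
    nonpositive drift [a] satisfies [- a < gamma_BRW sigma], that is,
    a^2 / (2 sigma^2) < log 4. *)
Lemma supercritical_drift : exists a : R, [/\ (a <= 0)%R, (a <= ln (rval l))%R &
  (1 < 4 * expR (- (a ^+ 2 / 2) / sigma ^+ 2))%R].
Proof.
exists (Num.min 0 (ln (rval l)))%R; split; [by rewrite ge_min lexx|by rewrite ge_min lexx orbT|].
set a := Num.min _ _; have a0 : (a <= 0)%R by rewrite ge_min lexx.
have ln4 : (0 < ln 4 :> R)%R by rewrite ln_gt0// (ltr_nat R 1 4).
have sq0 : (0 < Num.sqrt (2 * ln 4) :> R)%R by rewrite sqrtr_gt0 mulr_gt0.
have ga : (- a < gamma_BRW sigma)%R.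
  have : (0 < gamma_BRW sigma)%R by rewrite mulr_gt0.
  have [h|h] := leP 0%R (ln (rval l)).
    by rewrite /a min_l// oppr0.
  by rewrite /a (min_r (ltW h)) => _; move: supercritical; lra.
have : (a ^+ 2 < gamma_BRW sigma ^+ 2)%R.
  by rewrite -sqrrN ltrXn2r ?nnegrE ?oppr_ge0//; lra.
rewrite exprMn sqr_sqrtr ?mulr_ge0 ?ltW// => h.
rewrite -[X in (X * _)%R]lnK ?posrE//.
rewrite -expRD -[ltLHS]expR0 ltr_expR mulNr subr_gt0 ltr_pdivrMr ?exprn_gt0//.
by move: h; lra.
Qed.

(** Below the level where the linearisation is valid, a multiple of the bump
    lying under the tail remains under it when multiplied by some [Q > 1]. Hence
    [eps] times the bump is under the tail, wherever the bump is centred. *)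
Lemma tall_uniform_lower_bound : exists2 c : R, (0 < c)%R & forall z, (c <= g z)%R.
Proof.
have [a [a0 al crit]] := supercritical_drift.
set q0 := expR _ in crit.
have q00 : (0 < q0)%R by exact: expR_gt0.
have q01 : (q0 <= 1)%R.
  rewrite -expR0 ler_expR mulNr oppr_le0 divr_ge0 ?sqr_ge0//.
  by rewrite divr_ge0 ?sqr_ge0.
(* Small enough for [Q] to exceed 1 despite the two losses of order [eta]. *)
pose eta : R := ((4 * q0 - 1) / 32)%R.
have eta0 : (0 < eta)%R by rewrite divr_gt0//; lra.
have eta1 : (eta < 1)%R by rewrite /eta; lra.
pose Q : R := ((4 - eta) * (q0 * (1 - eta) ^+ 2))%R.
have Q1 : (1 < Q)%R.
  have e2 : (1 - 2 * eta <= (1 - eta) ^+ 2)%R.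
    have -> : ((1 - eta) ^+ 2 = 1 - 2 * eta + eta ^+ 2)%R by ring.
    by rewrite lerDl sqr_ge0.
  apply: (@lt_le_trans _ _ ((4 - eta) * (q0 * (1 - 2 * eta)))%R); last first.
    by rewrite ler_wpM2l ?ler_wpM2l//; lra.
  have -> : ((4 - eta) * (q0 * (1 - 2 * eta)) =
     4 * q0 - 9 * (q0 * eta) + 2 * q0 * eta ^+ 2)%R by ring.
  have : (0 <= 2 * q0 * eta ^+ 2)%R by rewrite mulr_ge0 ?sqr_ge0 ?mulr_ge0 ?ltW.
  have : (q0 * eta <= eta)%R by rewrite ler_piMl// ltW.
  by rewrite /eta; lra.
have [L L0 hL] := normal_bump sigma_gt0 eta0 eta1.
pose Bm : R := (expR (- a * L / sigma ^+ 2) * L)%R.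
have Bm0 : (0 < Bm)%R by rewrite mulr_gt0 ?expR_gt0.
have bB v : (bump sigma a L v <= Bm)%R.
  have [vL|vL] := leP L `|v|%R.
    by rewrite /bump tent_eq0// mulr0 ltW.
  rewrite /bump /Bm; apply: ler_pM; rewrite ?expR_ge0 ?tent_ge0 ?tent_le ?(ltW L0)//.
  rewrite ler_expR ler_pM2r ?invr_gt0 ?exprn_gt0//.
  have -> : (a * v = - a * - v)%R by ring.
  by rewrite ler_wpM2l//; move: vL; rewrite ltr_norml => /andP[]; lra.
have mbump : measurable_fun [set: R] (bump sigma a L).
  apply: measurable_funM; last exact: measurable_tent.
  by apply: measurableT_comp => //; apply: measurable_funM => //; exact: measurable_funM.
pose eps : R := (eta / (6 * Bm))%R.
have eps0 : (0 < eps)%R by rewrite divr_gt0// mulr_gt0.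
have improve z e : (0 <= e)%R -> (e <= eps)%R ->
    (forall v, e * bump sigma a L (v - z) <= g v)%R ->
    forall v, (Q * e * bump sigma a L (v - z) <= g v)%R.
  move=> e0 ee hg v.
  (* The shift by [ln (rval l) - a >= 0] replaces the drift by [a]; it is
     harmless because the tail is nonincreasing. *)
  pose h (u : R) : R := (e * bump sigma a L (u + (ln (rval l) - a) - z))%R.
  have mh : measurable_fun setT h.
    apply: measurable_funM => //; apply: measurableT_comp mbump _.
    by apply: measurable_funB => //; exact: measurable_funD.
  have h0 u : (0 <= h u)%R by rewrite mulr_ge0// bump_ge0.
  have hk u : (h u <= eta / 6)%R.
    apply: (@le_trans _ _ (eps * Bm)%R).
      by apply: ler_pM => //; exact: bump_ge0.
    have epsE (e2 b : R) : (0 < b -> e2 / (6 * b) * b = e2 / 6)%R.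
      by move=> b0; field; rewrite gt_eqF.
    by rewrite /eps epsE.
  have hhg u : (h u <= g u)%R.
    apply: le_trans (hg _) _; apply: tall_nonincreasing; lra.
  rewrite -lee_fin; apply: le_trans (tall_supersolution eta0 (ltW eta1) mh h0 hk hhg v).
  have -> : \int[N]_x (h (v - ln (rval l) - x))%:E =
      e%:E * \int[N]_x (bump sigma a L ((v - z) - a - x))%:E.
    rewrite -ge0_integralZl//; last 2 first.
    - apply/measurable_EFinP; apply: measurableT_comp mbump _; exact: measurable_funB.
    - by move=> x _; rewrite lee_fin bump_ge0.
    by apply: eq_integral => x _; rewrite -EFinM /h; congr (_ * bump _ _ _ _)%:E; ring.
  have c4 : (0 <= (4 - eta) * e)%R by rewrite mulr_ge0//; lra.
  rewrite muleA -EFinM; apply: le_trans (lee_wpmul2l _ (hL a (v - z)%R)); rewrite ?lee_fin//.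
  rewrite le_eqVlt; apply/orP; left; apply/eqP.
  by rewrite /Q /q0; ring.
exists (eps * L)%R => [|z]; first by rewrite mulr_gt0.
(* A small multiple of the bump fits under the tail, which is positive on its
   support. *)
pose e0 : R := Num.min eps (g (z + L) / Bm)%R.
have e00 : (0 < e0)%R by rewrite lt_min eps0 divr_gt0// tall_gt0.
have start v : (e0 * bump sigma a L (v - z) <= g v)%R.
  have [vL|vL] := leP L `|v - z|%R.
    by rewrite /bump tent_eq0// !mulr0 pr_ge0.
  apply: (@le_trans _ _ (g (z + L) / Bm * Bm)%R).
    apply: ler_pM; rewrite ?bump_ge0 ?(ltW e00)// ?bB//.
    by rewrite ge_min lexx orbT.
  rewrite divfK ?gt_eqF//; apply: tall_nonincreasing.
  by move: vL; rewrite ltr_norml => /andP[_]; lra.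
have iter n v : (Num.min eps (Q ^+ n * e0) * bump sigma a L (v - z) <= g v)%R.
  elim: n v => [|n IH] v.
    apply: le_trans (start v); rewrite ler_wpM2r ?bump_ge0// expr0 mul1r.
    by rewrite ge_min lexx orbT.
  have Qn0 : (0 <= Q ^+ n * e0)%R by rewrite mulr_ge0 ?exprn_ge0 ?ltW//; lra.
  have m0 : (0 <= Num.min eps (Q ^+ n * e0))%R by rewrite le_min Qn0 (ltW eps0).
  have m1 : (Num.min eps (Q ^+ n * e0) <= eps)%R by rewrite ge_min lexx.
  apply: le_trans (improve z _ m0 m1 IH v).
  have Q0 : (0 <= Q)%R by lra.
  apply: ler_wpM2r; first exact: bump_ge0.
  rewrite (minr_pMr _ _ Q0) exprS -mulrA le_min !ge_min lexx orbT andbT.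
  by rewrite ler_peMl ?(ltW eps0) ?(ltW Q1).
have [n hn] : exists n, (eps <= Q ^+ n * e0)%R.
  have Q0 : (0 < Q)%R by lra.
  have Qi0 : (0 <= Q^-1)%R by rewrite invr_ge0 ltW.
  have Qi1 : (Q^-1 < 1)%R by rewrite invf_lt1.
  have [n hn] := cvg_geo_small eps Qi0 Qi1 e00; exists n.
  by move: hn; rewrite exprVn ler_pdivrMr ?exprn_gt0// mulrC.
have := iter n z; rewrite subrr min_l//; apply: le_trans.
by rewrite /bump mulr0 mul0r expR0 mul1r tent0// ltW.
Qed.

(** The space is unbounded as soon as one of its four copies is, so the
    probability p of being bounded satisfies p <= p^4, while p < 1. *)
Lemma supercritical_unbounded :
  {ae mb, forall d : metrics R, diam [set: completion d] = +oo}.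
Proof.
have [c c0 hc] := tall_uniform_lower_bound.
pose Z := \bigcap_n (@tall R (expR n%:R)).
have ZE d : Z d <-> forall t, tall t d.
  split=> [hZ t|h n _]; last exact: h.
  apply: tall_le (hZ (Num.bound `|t|%R) I).
  apply: le_trans (ler_norm _) _; apply: le_trans (ltW (archi_boundP (normr_ge0 _))) _.
  by apply: le_trans (expR_ge1Dx _); rewrite lerDr.
have mZ : measurable Z by apply: bigcapT_measurable => n; exact: mtall.
have Zc : c%:E <= mb Z.
  pose F (n : nat) := @tall R (expR n%:R).
  have cF : mb \o F @ \oo --> mb Z.
    apply: nonincreasing_cvg_mu => //.
    - by rewrite ltey_eq fin_num_measure//; exact: mtall.
    - by move=> n; exact: mtall.
    - by move=> n k nk; apply/subsetPset => d; apply: tall_le; rewrite ler_expR ler_nat.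
  rewrite -(cvg_lim _ cF)//; apply: lime_ge; first by apply/cvg_ex; eexists; exact: cF.
  apply: nearW => n; rewrite /= prE; last exact: mtall.
  by rewrite lee_fin; exact: hc.
have mZC := measurableC mZ.
have mZC0 : mb (~` Z) = 0.
  have Zcopy (p : Rlambda_dom R) i : Z (quad p.1 i) -> Z (Rlambda l p).
    move=> /ZE hZ; apply/ZE => t.
    have lz : (0 < rval l * rval p.2)%R by rewrite mulr_gt0 ?rval_gt0.
    have [v hv] := hZ (t / (rval l * rval p.2))%R; exists (copy i v).
    by apply: lt_le_trans (height_Rlambda _ _ _ _); rewrite mulrC -ltr_pdivrMr.
  have : mb (~` Z) <= mb (~` Z) * mb (~` Z) * mb (~` Z) * mb (~` Z).
    have mP : measurable [set p : quad4 | forall i, (~` Z) (quad p i)].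
      by rewrite forall_quadE; do 3 (apply: measurableX => //).
    rewrite -prob_forall_quad// {1}(stationary_set mb_stationary)//.
    have -> : mb4 [set p : quad4 | forall i, (~` Z) (quad p i)] =
        law ([set p : quad4 | forall i, (~` Z) (quad p i)] `*` setT).
      rewrite [RHS](@product_measure1E _ _ _ _ _ mb4 m)//.
      by rewrite [X in _ * X](_ : _ = 1) ?mule1//; exact: probability_setT.
    apply: le_measure; rewrite ?inE.
    - apply: measurableC; apply: bigcapT_measurable => n.
      exact: measurable_tall (eval_measurable_Rlambda l).
    - exact: measurableX.
    - by move=> p /= hp; split => // i hi; apply: hp; exact: Zcopy hi.
  have x0 := pr_ge0 (~` Z); have x1 : (pr (~` Z) <= 1 - c)%R.
    have cZ : (c <= pr Z)%R by rewrite -lee_fin -prE.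
    rewrite -lee_fin -prE// probability_setC// prE// -EFinB lee_fin; lra.
  rewrite prE// -!EFinM lee_fin => h; congr (_%:E); apply/eqP.
  rewrite eq_le x0 andbT leNgt; apply/negP => xp.
  move: h; set x := pr (~` Z) in x0 x1 xp *.
  have : (x * x * x < 1)%R.
    by rewrite -[ltRHS]mulr1 -[ltRHS]mulr1 !ltr_pM ?mulr_ge0//; lra.
  by rewrite -(ltr_pM2r xp) mul1r => + /le_lt_trans h => /h; rewrite ltxx.
exists (~` Z); split => // d hd; apply: contra_not hd => /ZE hZ.
exact: tall_diam.
Qed.

End unbounded.

(** * The subcritical regime and the dichotomy *)

Section subcritical.
Context (R : realType) (sigma : R) (l : posreals R) (mb : probability (metrics R) R).
Hypothesis sigma_gt0 : 0 < sigma.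
Hypothesis mb_stationary : forall A, measurable A ->
  Phi l (lognormal sigma) mb A = mb A.
Hypothesis subcritical : gamma_BRW sigma + ln (rval l) < 0.

Let c : R := - (gamma_BRW sigma + ln (rval l)).
Let c_gt0 : 0 < c. Proof. by rewrite /c oppr_gt0. Qed.
Let s : R := Num.sqrt (2 * ln 4) / sigma.
Let ln4_gt0 : 0 < ln 4 :> R. Proof. by rewrite ln_gt0// (ltr_nat R 1 4). Qed.
Let s_gt0 : 0 < s.
Proof. by rewrite divr_gt0// sqrtr_gt0 mulr_gt0. Qed.

(** For this exponent [s ^+ 2 * sigma ^+ 2 / 2 = ln 4], so that the exponent
    log 4 + s log lambda + s^2 sigma^2 / 2 of the growth rate of the edge sums
    divided by [s], which is smallest here, is gamma_BRW + log lambda. *)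
Lemma lognormal_moment :
  (\int[lognormal sigma]_z ((rval l * rval z) `^ s)%:E = (expR (- (s * c)) / 4)%:E)%E.
Proof.
have mf : measurable_fun setT (fun z : posreals R => ((rval l * rval z) `^ s)%:E).
  apply/measurable_EFinP; apply: measurableT_comp (@measurable_powR R s) _.
  by apply: measurable_funM => //; exact: measurable_rval.
rewrite ge0_integral_distribution//; last by move=> z; rewrite lee_fin powR_ge0.
transitivity (\int[normal_prob 0 sigma]_x ((expR (s * ln (rval l)))%:E * (expR (s * x))%:E))%E.
  apply: eq_integral => x _; rewrite /= -EFinM -expRD; congr (_%:E).
  rewrite /powR mulf_eq0 !gt_eqF ?rval_gt0 ?expR_gt0//=.
  by rewrite lnM ?posrE ?rval_gt0 ?expR_gt0// expRK mulrDr.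
rewrite ge0_integralZl ?lee_fin ?expR_ge0//; last first.
  by apply/measurable_EFinP; apply: measurableT_comp => //; exact: measurable_funM.
rewrite normal_mgf// -EFinM -expRD; congr (_%:E).
rewrite -[X in _ = _ / X]lnK ?posrE// -expRN -expRD; congr expR.
have s2 : s ^+ 2 * sigma ^+ 2 = 2 * ln 4.
  by rewrite /s expr_div_n divfK ?expf_neq0 ?gt_eqF// sqr_sqrtr// mulr_ge0// ltW.
have sg : s * gamma_BRW sigma = 2 * ln 4.
  rewrite -s2 /gamma_BRW /s; set q := Num.sqrt _; field.
  by rewrite gt_eqF.
by rewrite s2 /c mulrN mulrDr sg; lra.
Qed.

Lemma subcritical_decay c' : 0 < c' -> c' < c ->
  {ae mb, forall d, exists2 C : R, 0 <= C & decay (mval d) C (expR (- c'))}.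
Proof.
move=> c'0 c'c; apply: (stationary_decay mb_stationary s_gt0 lognormal_moment).
  by rewrite expR_gt0 expR_lt1 oppr_lt0.
by rewrite -expRM ltr_expR mulNr ltrN2 mulrC ltr_pM2l.
Qed.

Lemma subcritical_homeomorphism : {ae mb, forall d : metrics R,
  exists2 f : Gamma_infty R -> completion d,
    homeomorphism f & forall v : Vinf, f (inclV (std_metric R) v) = inclV d v}.
Proof.
have c20 : 0 < c / 2 by move: c_gt0; lra.
have c2c : c / 2 < c by move: c_gt0; lra.
apply: filterS2 (stationary_separates mb_stationary) (subcritical_decay c20 c2c).
move=> d sep [C C0 hd]; apply: (decay_homeomorphism sep _ _ C0 hd); first exact: expR_ge0.
by rewrite expR_lt1 oppr_lt0.
Qed.

(** Decay at rate [c'] bounds the dimension by [ln 4 / c']; the countably many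
    rates [ck k], which increase to [c], are enough. *)
Lemma subcritical_dimension : {ae mb, forall d : metrics R,
  (hausdorff_dim [set: completion d] <=
   (2 * ln 2 / `|gamma_BRW sigma + ln (rval l)|)%:E)%E}.
Proof.
pose ck (k : nat) : R := c * (1 - k.+2%:R^-1).
have k2 (k : nat) : (0 : R) < k.+2%:R^-1 /\ k.+2%:R^-1 < (1 : R).
  by rewrite invr_gt0 ltr0n invf_lt1 ?ltr0n// ltr1n.
have ck0 k : 0 < ck k by have [_ k21] := k2 k; rewrite mulr_gt0// subr_gt0.
have ckc k : ck k < c by have [k20 _] := k2 k; rewrite gtr_pMr// gtrBl.
have : {ae mb, forall d, forall k, exists2 C : R, 0 <= C & decay (mval d) C (expR (- ck k))}.
  by apply: ae_foralln => k; exact: subcritical_decay.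
apply: filterS => d hd.
have -> : 2 * ln 2 = ln 4 :> R.
  have -> : 4 = 2 ^+ 2 :> R by rewrite -natrX.
  by rewrite lnXn// mulr_natl.
rewrite ltr0_norm// -/c; apply/lee_addgt0Pr => e e0; rewrite -EFinD.
set h := ln 4 / c + e.
have h0 : 0 < h by rewrite addr_gt0// divr_gt0.
apply: ereal_inf_lbound; exists h => //; split => //.
pose k := Num.bound (h / e); have [C C0 hC] := hd k.
apply: (hausdorff_measure_decay0 _ C0 hC h0).
  by rewrite expR_gt0 expR_lt1 oppr_lt0 ck0.
rewrite -[X in X * _]lnK ?posrE// -expRM -expRD -[ltRHS]expR0 ltr_expR mulNr subr_lt0.
have hk : h / e < k.+2%:R.
  apply: lt_trans (archi_boundP _) _; first by rewrite divr_ge0// ltW.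
  by rewrite ltr_nat /k; lia.
have ch : c * h = ln 4 + c * e by rewrite /h mulrDr mulrCA divff ?mulr1// gt_eqF.
have hk' : h * k.+2%:R^-1 < e.
  by rewrite ltr_pdivrMr ?ltr0n// mulrC -ltr_pdivrMr.
have -> : ck k * h = c * h - c * (h * k.+2%:R^-1) by rewrite /ck; ring.
by rewrite ch ltrBrDr ltrD2l ltr_pM2l.
Qed.

End subcritical.

Theorem theorem3 (R : realType) (sigma : R) (A : R) (lcr : posreals R)
    (mbar : probability (metrics R) R)
    (sigma_gt0 : 0 < sigma) (A_gt0 : 0 < A)
    (lcrE : rval lcr = lambda_cr A (lognormal sigma))
    (mbar_stationary : stationary_random_metric lcr (lognormal sigma) mbar)
    (mbar_non_atomic : non_atomic mbar) :
  (gamma_BRW sigma + ln (rval lcr) < 0 ->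
    {ae mbar, forall d : metrics R,
      exists2 f : Gamma_infty R -> completion d,
        homeomorphism f & forall v : Vinf, f (inclV (std_metric R) v) = inclV d v}
    /\
    {ae mbar, forall d : metrics R,
      (hausdorff_dim [set: completion d]
        <= (2 * ln 2 / `|gamma_BRW sigma + ln (rval lcr)|)%:E)%E})
  /\
  (0 < gamma_BRW sigma + ln (rval lcr) ->
    {ae mbar, forall d : metrics R, diam [set: completion d] = +oo%E}).
Proof.
have [_ st] := mbar_stationary; split=> [sub|sup].
  split; first exact: subcritical_homeomorphism st sub.
  exact: subcritical_dimension st sub.
exact: supercritical_unbounded st sup.
Qed.
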